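(* Let $\dot x = Ax+g(x)$ on $\mathbb{R}^n$, let $\mathcal{M}$ be a $d$-dimensional invariant manifold through the origin tangent there to eigenvectors $e_1,\dots,e_d$ of $A$ with eigenvalues $\lambda_1,\dots,\lambda_d$, and let $\mu:\mathbb{R}^n\to\mathbb{R}$ be a differentiable scalar observable with delay-embedding (sampling) map $S:\mathbb{R}^n\to\mathbb{R}^p$ of timelag $\tau>0$, embedding $\mathcal{M}$ onto $\tilde{\mathcal{M}}=S(\mathcal{M})\subset\mathbb{R}^p$ (all as specified in the context). Assume that $\mu$ is generic, in the sense that $\left.\frac{\partial\mu}{\partial z_k}\right|_{0}\neq 0$ for all $k\in\{1,\dots,d\}$, and that $\lambda_1,\dots,\lambda_d$ are pairwise distinct. Let $V\in\mathbb{C}^{p\times d}$ be the Vandermonde matrix whose $k$-th column is $(1,\mathrm{e}^{\lambda_k\tau},\dots,\mathrm{e}^{(p-1)\lambda_k\tau})^{\top}$, let $\Lambda=\operatorname{diag}(\lambda_1,\dots,\lambda_d)$, let $V^\dagger$ be the Moore–Penrose pseudoinverse of $V$, and let $y_0=S(0)$. Then the columns of $V$ are eigenvectors of the linearization at $y_0$ of the delay-embedded system on $\tilde{\mathcal{M}}$, and the dynamics in the observable space (i.e. of $y(t)=S(x(t))\in\tilde{\mathcal{M}}$ with $x(t)\in\mathcal{M}$) can be written as $$\dot y = V\Lambda V^{\dagger}(y-y_0)+o(|y-y_0|).$$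
   Context: System: $\dot x = Ax+g(x)$, $x\in\mathbb{R}^n$, of class $\mathcal{C}^l$ with $l\in\mathbb{N}^+\cup\{\infty,a\}$ ($a$ = analytic), $g:\mathbb{R}^n\to\mathbb{R}^n$, $g(x)=\mathcal{O}(|x|^2)$, and $A\in\mathbb{R}^{n\times n}$ diagonalizable (over $\mathbb{C}$) with eigenvalues $\lambda_1,\dots,\lambda_n$ and eigenvectors $e_1,\dots,e_n$; $E=[e_1,\dots,e_n]$. The flow map is $F^t(x_0)=x(t,x_0)$, assumed defined for the times used. Modal coordinates: $z=E^{-1}x\in\mathbb{C}^n$. The observable is viewed as a function of $z$ through $\mu(x)=\mu(Ez)$, so $\left.\frac{\partial\mu}{\partial z_k}\right|_{0}=D\mu(0)e_k$, with $D\mu(0)$ extended complex-linearly. Invariant manifold: $\mathcal{M}\subset\mathbb{R}^n$ is a $d$-dimensional invariant manifold of the flow containing $0$, with $T_0\mathcal{M}=\operatorname{span}\{e_1,\dots,e_d\}$. Delay embedding: $S:\mathbb{R}^n\to\mathbb{R}^p$, $S(x)=\big(\mu(x),\mu(F^{\tau}(x)),\mu(F^{2\tau}(x)),\dots,\mu(F^{(p-1)\tau}(x))\big)^{\top}$. The conditions of Takens's embedding theorem are assumed to hold, in the sense that $\Psi:=S|_{\mathcal{M}}:\mathcal{M}\to\tilde{\mathcal{M}}:=S(\mathcal{M})$ is a smooth (at least $C^1$) embedding with smooth inverse. The fixed point in the observable space is $y_0=S(0)=(\mu(0),\dots,\mu(0))^\top$. Delay-embedded system: the flow on $\tilde{\mathcal{M}}$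 is $\Psi\circ F^t\circ\Psi^{-1}$, generated by the vector field $\tilde f(y)=D\Psi(x)\,(Ax+g(x))$ with $x=\Psi^{-1}(y)$; its linearization at $y_0$ is the linear map $D\tilde f(y_0)=D\Psi(0)\circ A|_{T_0\mathcal{M}}\circ (D\Psi(0))^{-1}$ on $T_{y_0}\tilde{\mathcal{M}}$. Convention: tangent spaces and linear maps on them are complexified where complex eigenvectors occur (e.g. $T_0\mathcal{M}\otimes\mathbb{C}$ is the complex span of $e_1,\dots,e_d$). *)

(* Defs.v *)
From HB Require Import structures.
From mathcomp Require Import all_boot all_order all_algebra complex.
From mathcomp Require Import all_classical all_reals all_analysis.

Set Implicit Arguments.
Unset Strict Implicit.
Unset Printing Implicit Defensive.

Import Order.TTheory GRing.Theory Num.Theory.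
Import numFieldNormedType.Exports.
Local Open Scope classical_set_scope.
Local Open Scope ring_scope.

Definition cexp (R : realType) (z : R[i]) : R[i] :=
  let: Complex a b := z in Complex (expR a * cos b) (expR a * sin b).

Definition cplx (R : realType) (m n : nat) (A : 'M[R]_(m, n)) : 'M[R[i]]_(m, n) :=
  map_mx (real_complex R) A.
Definition re_mx (R : realType) (m n : nat) (A : 'M[R[i]]_(m, n)) : 'M[R]_(m, n) :=
  map_mx (@complex.Re R) A.
Definition im_mx (R : realType) (m n : nat) (A : 'M[R[i]]_(m, n)) : 'M[R]_(m, n) :=
  map_mx (@complex.Im R) A.

Definition ctrmx (C : numClosedFieldType) (m n : nat) (A : 'M[C]_(m, n)) :
    'M[C]_(n, m) :=
  map_mx Num.conj A^T.

Definition penrose (C : numClosedFieldType) (m n : nat)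
    (A : 'M[C]_(m, n)) (X : 'M[C]_(n, m)) : Prop :=
  [/\ A *m X *m A = A, X *m A *m X = X,
      ctrmx (A *m X) = A *m X & ctrmx (X *m A) = X *m A].

Definition mppinv (C : numClosedFieldType) (m n : nat) (A : 'M[C]_(m, n)) :
    'M[C]_(n, m) :=
  xget 0 [set X | penrose A X].

Lemma ctrmxE (C : numClosedFieldType) (m n : nat) (A : 'M[C]_(m, n)) i j :
  ctrmx A i j = Num.conj (A j i).
Proof. by rewrite !mxE. Qed.

Lemma ctrmxM (C : numClosedFieldType) (m n q : nat)
    (A : 'M[C]_(m, n)) (B : 'M[C]_(n, q)) :
  ctrmx (A *m B) = ctrmx B *m ctrmx A.
Proof. by rewrite /ctrmx trmx_mul map_mxM. Qed.

Lemma ctrmxK (C : numClosedFieldType) (m n : nat) (A : 'M[C]_(m, n)) :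
  ctrmx (ctrmx A) = A.
Proof. by apply/matrixP => i j; rewrite !mxE conjCK. Qed.

Lemma ctrmxV (C : numClosedFieldType) (n : nat) (A : 'M[C]_n) :
  ctrmx (invmx A) = invmx (ctrmx A).
Proof. by rewrite /ctrmx trmx_inv map_invmx. Qed.

Lemma row_free_gram (C : numClosedFieldType) (m n : nat) (B : 'M[C]_(m, n)) :
  row_free B -> B *m ctrmx B \in unitmx.
Proof.
move=> Bf; rewrite -row_free_unit; apply/inj_row_free => u.
move=> /(congr1 (mulmx^~ (ctrmx u))); rewrite mul0mx => uBBu.
have uB0 : (u *m B) *m ctrmx (u *m B) = 0 by rewrite ctrmxM !mulmxA in uBBu *.
have /eqP : u *m B = 0.
  apply/matrixP => i j; rewrite !ord1 [RHS]mxE; apply/eqP; rewrite -normr_eq0.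
  have /matrixP/(_ 0 0) := uB0; rewrite mxE [RHS]mxE.
  under eq_bigr => k _ do rewrite ctrmxE -normCK.
  move/eqP; rewrite psumr_eq0 => [/allP/(_ j (mem_index_enum _))|k _].
    by rewrite /= expf_eq0.
  exact: exprn_ge0.
by rewrite mulmx_free_eq0 // => /eqP.
Qed.

Lemma penrose_rank_factorization (C : numClosedFieldType) (m n r : nat)
    (L : 'M[C]_(m, r)) (B : 'M[C]_(r, n)) :
  ctrmx L *m L \in unitmx -> B *m ctrmx B \in unitmx ->
  penrose (L *m B)
    (ctrmx B *m invmx (B *m ctrmx B) *m invmx (ctrmx L *m L) *m ctrmx L).
Proof.
move=> LL BB; set X := (X in penrose _ X).
have AX : L *m B *m X = L *m invmx (ctrmx L *m L) *m ctrmx L.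
  by rewrite /X !mulmxA -(mulmxA L B) mulmxK.
have XA : X *m (L *m B) = ctrmx B *m invmx (B *m ctrmx B) *m B.
  by rewrite /X !mulmxA -(mulmxA _ (ctrmx L) L) mulmxKV.
split.
- by rewrite AX !mulmxA -(mulmxA _ (ctrmx L) L) mulmxKV.
- by rewrite XA /X !mulmxA -(mulmxA _ B (ctrmx B)) mulmxKV.
- by rewrite AX !ctrmxM ctrmxV ctrmxM ctrmxK mulmxA.
- by rewrite XA !ctrmxM ctrmxV ctrmxM ctrmxK mulmxA.
Qed.

Lemma penrose_exists (C : numClosedFieldType) (m n : nat) (A : 'M[C]_(m, n)) :
  exists X, penrose A X.
Proof.
have BB := row_free_gram (row_base_free A).
have LL : ctrmx (col_base A) *m col_base A \in unitmx.
  rewrite -{2}(ctrmxK (col_base A)); apply: row_free_gram.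
  by rewrite /row_free /ctrmx mxrank_map mxrank_tr; exact: col_base_full.
by have := penrose_rank_factorization LL BB; rewrite mulmx_base; eexists; eassumption.
Qed.

Lemma mppinvP (C : numClosedFieldType) (m n : nat) (A : 'M[C]_(m, n)) :
  penrose A (mppinv A).
Proof. by have [X XP] := penrose_exists A; exact: (@xgetPex _ 0 [set X | penrose A X] (ex_intro _ X XP)). Qed.

Lemma penrose_unique (C : numClosedFieldType) (m n : nat)
    (A : 'M[C]_(m, n)) (X Y : 'M[C]_(n, m)) :
  penrose A X -> penrose A Y -> X = Y.
Proof.
move=> [AXA XAX AXh XAh] [AYA YAY AYh YAh].
have AXY : A *m X = A *m Y.
  by rewrite -AXh -{1}AYA -mulmxA ctrmxM AXh AYh !mulmxA AXA.
have XAY : X *m A = Y *m A.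
  have -> : X *m A = X *m A *m (Y *m A) by rewrite -{1}AYA !mulmxA.
  by rewrite -[LHS]ctrmxK ctrmxM XAh YAh -mulmxA (mulmxA A) AXA YAh.
by rewrite -XAX -mulmxA AXY mulmxA XAY.
Qed.

(* For maps on an open subset of a finite-dimensional space, continuity of the
   derivative amounts to continuity of all directional derivatives. *)
Fixpoint Ck_on (R : realType) (V W : normedModType R) (k : nat)
    (U : set V) (f : V -> W) : Prop :=
  match k with
  | 0 => forall x, U x -> {for x, continuous f}
  | k'.+1 => (forall x, U x -> differentiable f x) /\
             (forall v, Ck_on k' U (fun x => 'D_v f x))
  end.

(* Local expansion in an absolutely convergent multivariate power series
   sum_a c_a h^a, summed over the boxes [0, N)^n of multi-indices. *)
Definition analytic (R : realType) (n m : nat)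
    (f : 'cV[R]_n -> 'cV[R]_m) : Prop :=
  forall x : 'cV[R]_n, exists (c : {ffun 'I_n -> nat} -> 'cV[R]_m) (r : R),
    0 < r /\ forall h : 'cV[R]_n, `|h| < r ->
    let term (N : nat) (a : {ffun 'I_n -> 'I_N}) : 'cV[R]_m :=
      (\prod_i h i 0 ^+ a i) *: c [ffun i => nat_of_ord (a i)] in
    (exists B : R, forall N : nat, \sum_a `|term N a| <= B) /\
    (fun N : nat => \sum_a term N a) @ \oo --> f (x + h).

Inductive smoothness := Cpow of nat | Csmooth | Canalytic.

Definition of_class (R : realType) (n m : nat) (l : smoothness)
    (f : 'cV[R]_n -> 'cV[R]_m) : Prop :=
  match l with
  | Cpow k => (0 < k)%N /\ Ck_on k setT f
  | Csmooth => forall k : nat, Ck_on k setT f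
  | Canalytic => analytic f
  end.

(* C^1 maps and submanifolds of Euclidean space: a map on an arbitrary subset is
   C^1 if it locally extends to a C^1 map on an open set of the ambient space,
   and a d-dimensional submanifold is a subset locally C^1-diffeomorphic to open
   subsets of R^d. *)
Definition C1_on (R : realType) (V W : normedModType R)
    (A : set V) (f : V -> W) : Prop :=
  forall x, A x -> exists (U : set V) (h : V -> W),
    [/\ open U, U x, Ck_on 1 U h & forall y, A y -> U y -> h y = f y].

Definition submanifold (R : realType) (n d : nat) (M : set 'cV[R]_n) : Prop :=
  forall x, M x ->
  exists (U : set 'cV[R]_n) (W : set 'cV[R]_d)
         (phi : 'cV[R]_d -> 'cV[R]_n) (psi : 'cV[R]_n -> 'cV[R]_d),
    [/\ open U /\ U x, open W, Ck_on 1 W phi /\ C1_on (M `&` U) psi,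
        phi @` W = M `&` U & forall w, W w -> psi (phi w) = w].

Definition curve_in (R : realType) (n : nat) (M : set 'cV[R]_n)
    (x v : 'cV[R]_n) (gam : R -> 'cV[R]_n) : Prop :=
  [/\ gam 0 = x, \forall t \near (0 : R), M (gam t)
    & is_derive (0 : R) (1 : R) gam v].

Definition tangent (R : realType) (n : nat) (M : set 'cV[R]_n) (x : 'cV[R]_n) :
    set 'cV[R]_n :=
  [set v | exists gam, curve_in M x v gam].

Definition ctangent (R : realType) (n : nat) (M : set 'cV[R]_n)
    (x : 'cV[R]_n) : set 'cV[R[i]]_n :=
  [set w | tangent M x (re_mx w) /\ tangent M x (im_mx w)].

(* The differential at x of the restriction of f to M, applied to a tangent
   vector v, computed along any curve of M with velocity v. *)
Definition mdiff (R : realType) (n p : nat) (M : set 'cV[R]_n)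
    (f : 'cV[R]_n -> 'cV[R]_p) (x v : 'cV[R]_n) : 'cV[R]_p :=
  xget 0 [set w | exists gam, curve_in M x v gam /\
                    is_derive (0 : R) (1 : R) (f \o gam) w].

(* psi is the inverse of the restriction of f to M. *)
Definition C1_embedding (R : realType) (n p : nat) (M : set 'cV[R]_n)
    (f : 'cV[R]_n -> 'cV[R]_p) (psi : 'cV[R]_p -> 'cV[R]_n) : Prop :=
  [/\ C1_on M f, C1_on (f @` M) psi & forall x, M x -> psi (f x) = x].

Definition solution_on (R : realType) (n : nat)
    (f : 'cV[R]_n -> 'cV[R]_n) (a b : R) (x : R -> 'cV[R]_n) : Prop :=
  forall t : R, a < t < b -> is_derive t (1 : R) x (f (x t)).

(* F is the flow of x' = f x, required to exist only on a neighbourhood of the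
   time interval [0, T]. *)
Definition flow_upto (R : realType) (n : nat)
    (f : 'cV[R]_n -> 'cV[R]_n) (T : R) (F : R -> 'cV[R]_n -> 'cV[R]_n) : Prop :=
  forall x0 : 'cV[R]_n, F 0 x0 = x0 /\
    exists a b : R, [/\ a < 0, T < b & solution_on f a b (F ^~ x0)].

Definition flow_invariant (R : realType) (n : nat)
    (f : 'cV[R]_n -> 'cV[R]_n) (M : set 'cV[R]_n) : Prop :=
  forall (a b : R) (x : R -> 'cV[R]_n), a < 0 < b -> solution_on f a b x ->
    M (x 0) -> forall t : R, a < t < b -> M (x t).

Definition delay_map (R : realType) (n p : nat)
    (F : R -> 'cV[R]_n -> 'cV[R]_n) (mu : 'cV[R]_n -> R) (tau : R)
    (x : 'cV[R]_n) : 'cV[R]_p :=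
  \col_(j < p) mu (F (j%:R * tau) x).

Definition delay_field (R : realType) (n p : nat)
    (f : 'cV[R]_n -> 'cV[R]_n) (M : set 'cV[R]_n)
    (S : 'cV[R]_n -> 'cV[R]_p) (Psiinv : 'cV[R]_p -> 'cV[R]_n)
    (y : 'cV[R]_p) : 'cV[R]_p :=
  mdiff M S (Psiinv y) (f (Psiinv y)).

(* L represents the linearization at y0 of a vector field f on N: an
   endomorphism of the tangent space of N at y0 (only its values there matter)
   that is the derivative of f at the fixed point y0 along N. *)
Definition linearization (R : realType) (p : nat) (N : set 'cV[R]_p)
    (f : 'cV[R]_p -> 'cV[R]_p) (y0 : 'cV[R]_p) (L : 'M[R]_p) : Prop :=
  [/\ f y0 = 0, forall v, tangent N y0 v -> tangent N y0 (L *m v)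
    & (fun y => f y - L *m (y - y0)) =o_ (within N (nbhs y0)) (fun y => y - y0)].

Definition tangent_eigenvector (R : realType) (p : nat) (N : set 'cV[R]_p)
    (y0 : 'cV[R]_p) (L : 'M[R]_p) (lam : R[i]) (v : 'cV[R[i]]_p) : Prop :=
  [/\ v != 0, ctangent N y0 v & cplx L *m v = lam *: v].

(* D mu (x) extended complex-linearly, applied to w. *)
Definition cdiff (R : realType) (n : nat) (mu : 'cV[R]_n -> R)
    (x : 'cV[R]_n) (w : 'cV[R[i]]_n) : R[i] :=
  Complex ('d (mu : 'cV[R]_n -> R^o) x (re_mx w))
          ('d (mu : 'cV[R]_n -> R^o) x (im_mx w)).

Definition delay_vandermonde (R : realType) (d p : nat)
    (lam : 'I_d -> R[i]) (tau : R) : 'M[R[i]]_(p, d) :=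
  \matrix_(j < p, k < d) cexp (j%:R * lam k * tau%:C%C).

(* Main.v *)
Require Import Defs.
From HB Require Import structures.
From mathcomp Require Import all_boot all_order all_algebra complex.
From mathcomp Require Import all_classical all_reals all_analysis.
From mathcomp Require Import ring lra.

Set Implicit Arguments.
Unset Strict Implicit.
Unset Printing Implicit Defensive.

Import Order.TTheory GRing.Theory Num.Theory.
Import numFieldNormedType.Exports.
Local Open Scope classical_set_scope.
Local Open Scope ring_scope.

(** Everything is read off from the derivative of the delay map S at the fixed
    point. Near 0 the flow is e^(tA) x + O(|x|^2), so the j-th component of
    DS(0) is Dmu(0) e^(j tau A), and DS(0) sends e_k to c_k v_k, where
    c_k = Dmu(0) e_k and v_k is the k-th column of V ([delay_map_modes]). Since S
    restricts to an embedding, DS(0) is injective on T_0 M; as no c_k vanishes,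
    the v_k are linearly independent and span the complexified tangent space of
    S(M) at y0. Hence V^+ V = 1, and B = V Lambda V^+ satisfies
    B DS(0) = DS(0) A on T_0 M ([reduced_matrix_intertwines]). The span of
    e_1, ..., e_d is stable under conjugation, being the complexification of a
    real space, and this forces B to be a real matrix ([reduced_matrix_real]).

    For x in M, the reduced field at y = S(x) is DS(x)(A x + g(x)), which is
    DS(0) A x + o(|x|), whereas B (y - y0) = B DS(0) x + o(|x|). The difference
    of the main terms is the image of x under a matrix that vanishes on T_0 M,
    and such an image is o(|x|) along M ([tangent_approx]); since the inverse of
    the embedding is Lipschitz at y0, an o(|x|) is an o(|y - y0|)
    ([reduced_field_estimate], [transport_littleo]). So B is a linearization.
    Two linearizations differ by a matrix D with D (y - y0) = o(|y - y0|) on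
    S(M), and such a D vanishes on tangent vectors ([tangent_kernel]); hence
    every linearization has the v_k as eigenvectors, as B has.

    The expansion of the flow ([flow_linearization]) avoids the matrix
    exponential. A Gronwall estimate keeps a solution within a constant multiple
    of its small initial value, and then each modal coordinate z_k solves a
    scalar equation z' = lambda_k z + O(|x(0)|^2), which is integrated
    explicitly in real and imaginary parts ([oscillator_duhamel]). *)

(** * Norms and derivatives of curves *)

Lemma coord_le_norm (R : realType) (m n : nat) (x : 'M[R]_(m, n)) i j :
  `|x i j| <= `|x|.
Proof.
by rewrite [leRHS]/Num.Def.normr/= mx_normrE; exact: (le_bigmax _ _ (i, j)).
Qed.

Lemma norm_le_coord (R : realType) (m n : nat) (x : 'M[R]_(m, n)) c :
  0 <= c -> (forall i j, `|x i j| <= c) -> `|x| <= c.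
Proof.
by move=> c0 xc; rewrite [leLHS]/Num.Def.normr/= mx_normrE bigmax_le.
Qed.

Lemma mulmx_lipschitz (R : realType) (m n : nat) (A : 'M[R]_(m, n)) :
  exists2 k, 0 < k & forall x : 'cV[R]_n, `|A *m x| <= k * `|x|.
Proof.
pose k0 := \sum_i \sum_j `|A i j|.
have k00 : 0 <= k0 by apply: sumr_ge0 => i _; exact: sumr_ge0.
exists (k0 + 1) => [|x]; first by rewrite ltr_wpDl.
apply: norm_le_coord => [|i j]; first by rewrite mulr_ge0// addr_ge0.
rewrite mxE (le_trans (ler_norm_sum _ _ _))//.
apply: (@le_trans _ _ (\sum_j `|A i j| * `|x|)).
  by apply: ler_sum => l _; rewrite normrM ler_wpM2l// coord_le_norm.
rewrite -mulr_suml ler_wpM2r// (@le_trans _ _ k0)// ?lerDl//.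
rewrite /k0 (bigD1 i)//= lerDl sumr_ge0// => l _; exact: sumr_ge0.
Qed.

Lemma is_derive_coord (R : realType) (m n : nat) (x : R -> 'M[R]_(m, n)) (t : R) v i j :
  is_derive t 1 x v -> is_derive t 1 (fun s => x s i j) (v i j).
Proof.
move=> [dx <-]; apply: DeriveDef; first by move/derivable_mxP : dx; exact.
by rewrite derive_mx// mxE.
Qed.

Lemma is_derive_continuous (R : realType) (V : normedModType R) (x : R -> V) (t : R) v :
  is_derive t 1 x v -> {for t, continuous x}.
Proof. by move=> [/derivable1_diffP dx _]; exact: differentiable_continuous. Qed.

Lemma within_continuous_is_derive (R : realType) (f df : R -> R) (a b : R) :
  (forall t, a <= t <= b -> is_derive t 1 f (df t)) -> {within `[a, b], continuous f}.
Proof.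
move=> fdf; apply: derivable_within_continuous => t; rewrite in_itv/= => tab.
by have [] := fdf _ tab.
Qed.

Lemma mulmx_continuous (R : realType) (m n : nat) (B : 'M[R]_(m, n)) :
  continuous (mulmx B : 'cV[R]_n -> 'cV[R]_m).
Proof.
have [k k0 Bk] := mulmx_lipschitz B.
move=> y; apply/(@cvgrPdist_le _ _ _ (nbhs y) (nbhs_filter y)) => e e0; apply/nbhs_ballP.
exists (e / k) => [|z]; rewrite /= ?divr_gt0// -ball_normE/= => /ltW yz.
by rewrite -mulmxBr (le_trans (Bk _))// mulrC -ler_pdivlMr.
Qed.

Lemma is_derive_comp1 (R : realType) (V W : normedModType R) (f : V -> W)
    (x : R -> V) (t : R) v : differentiable f (x t) ->
  is_derive t 1 x v -> is_derive t 1 (f \o x) ('d f (x t) v).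
Proof.
move=> df [dx <-]; have dx' : differentiable x t by apply/derivable1_diffP.
apply: DeriveDef; first exact/derivable1_diffP/differentiable_comp.
have dfx := differentiable_comp dx' df.
by rewrite (deriveE _ dfx) (diff_comp dx' df) /= (deriveE _ dx').
Qed.

Lemma is_derive_mulmx (R : realType) (m n : nat) (B : 'M[R]_(m, n))
    (x : R -> 'cV[R]_n) (t : R) v :
  is_derive t 1 x v -> is_derive t 1 (fun s => B *m x s) (B *m v).
Proof.
have cB := @mulmx_continuous _ _ _ B.
move=> dx.
rewrite -[X in is_derive _ _ _ X](_ :
    'd (mulmx B : 'cV[R]_n -> 'cV[R]_m) (x t) v = _).
  exact: is_derive_comp1 (linear_differentiable _ cB) dx.
by rewrite diff_lin.
Qed.

(** * A priori bounds for differential inequalities *)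

Lemma le_norm_increment (R : realType) (f df : R -> R) (T m t : R) :
  (forall s, 0 <= s <= T -> is_derive s 1 f (df s)) ->
  (forall s, 0 <= s <= T -> `|df s| <= m) ->
  0 <= t <= T -> `|f t - f 0| <= T * m.
Proof.
move=> fdf dfm /andP[t0 tT].
have tsub s : 0 <= s <= t -> 0 <= s <= T.
  by move=> /andP[-> st]; exact: le_trans tT.
have [s||s] := @MVT_segment _ f df 0 t t0.
- by rewrite in_itv/= => /andP[s0 st]; apply: fdf; rewrite (ltW s0) (le_trans (ltW st)).
- by apply: (@within_continuous_is_derive _ _ df) => s /tsub; exact: fdf.
rewrite in_itv/= => /tsub sT ->.
by rewrite normrM subr0 (ger0_norm t0) mulrC ler_pM// dfm.
Qed.

(** Gronwall's inequality under a hypothesis that holds only below the level r,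
    as happens for a vector field controlled near an equilibrium only. The bound
    itself stays below r, so the level is never reached: at a first time s with
    r <= q s, the inequality would be available on ]0, s[ and give q s < r. *)
Lemma le_expR_of_deriv_le_below (R : realType) (q dq : R -> R) (K r T : R) :
  0 <= K -> (forall t, 0 <= t <= T -> 0 <= q t) ->
  (forall t, 0 <= t <= T -> is_derive t 1 q (dq t)) ->
  (forall t, 0 <= t <= T -> q t <= r -> dq t <= K * q t) ->
  q 0 * expR (K * T) < r ->
  forall t, 0 <= t <= T -> q t <= q 0 * expR (K * T) /\ q t < r.
Proof.
move=> K0 q0 qdq dqK q0r.
have main s : 0 <= s <= T -> (forall u, 0 < u < s -> q u <= r) ->
    q s <= q 0 * expR (K * T).
  move=> /andP[s0 sT] qr.
  pose psi u := q u * expR (- K * u).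
  pose dpsi u := (dq u - K * q u) * expR (- K * u).
  have usub u : 0 <= u <= s -> 0 <= u <= T.
    by move=> /andP[-> /le_trans]; apply.
  have dpsiP u : 0 <= u <= s -> is_derive u 1 psi (dpsi u).
    move=> /usub /qdq qu.
    have h : is_derive u 1 (fun u => - K * u) (- K).
      apply: (is_derive_eq (@is_deriveZ _ _ _ id (- K) u 1 1 _)).
      by rewrite /GRing.scale/= mulr1.
    have e : is_derive u 1 (expR \o (fun u => - K * u)) (- K * expR (- K * u)).
      apply: is_derive_eq; rewrite /GRing.scale/=; ring.
    apply: (is_derive_eq (is_deriveM qu e)).
    rewrite /dpsi/= /GRing.scale/=; ring.
  have psi0 : psi s <= psi 0.
    apply: (@ler0_derive1_nincr _ psi 0 s) => // [u|u|].
    - rewrite in_itv/= => /andP[u0 us].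
      by have [] : is_derive u 1 psi (dpsi u) by apply: dpsiP; rewrite !ltW.
    - rewrite in_itv/= => /andP[u0 us]; rewrite derive1E.
      have us' : 0 <= u <= s by rewrite !ltW.
      have := dpsiP _ us' => -[_ ->].
      rewrite /dpsi mulr_le0_ge0 ?expR_ge0// subr_le0 dqK//; first exact: usub.
      by apply: qr; rewrite u0.
    - exact: (within_continuous_is_derive dpsiP).
  have qs : q s <= q 0 * expR (K * s).
    rewrite -(ler_pM2r (expR_gt0 (- K * s))) -mulrA -expRD mulNr subrr expR0.
    by move: psi0; rewrite /psi mulr0 expR0 mulNr.
  rewrite (le_trans qs)// ler_wpM2l ?ler_expR ?ler_wpM2l//.
  by apply: q0; rewrite lexx (le_trans s0).
suff below t : 0 <= t <= T -> q t < r.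
  move=> t tT; split; last exact: below.
  apply: main => // u /andP[u0 ut]; apply/ltW/below.
  by rewrite (ltW u0) (le_trans (ltW ut))//; case/andP: tT.
move=> tT; rewrite ltNge; apply/negP => qtr.
pose B := [set u | 0 <= u <= t /\ r <= q u].
have Bt : B t by split => //; move: tT => /andP[->] /=; rewrite lexx.
have hB : has_inf B by split; [exists t | exists 0 => u [/andP[]]].
pose s := inf B.
have s0 : 0 <= s by apply: lb_le_inf; [exists t | move=> u [/andP[]]].
have st : s <= t by apply: ge_inf => //; case: hB.
have sT : 0 <= s <= T by rewrite s0 (le_trans st)//; case/andP: tT.
have rs : r <= q s.
  have cq := is_derive_continuous (qdq _ sT).
  rewrite leNgt; apply/negP => qsr.
  have /nbhs_ballP[e/= e0 eP] : \forall u \near s, q u < r.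
    exact: (cvgr_lt _ cq).
  have [u Bu us] := inf_adherent e0 hB.
  have : q u < r.
    apply: eP; rewrite /ball/= distrC ger0_norm ?subr_ge0 ?ltrBlDl//.
    by apply: ge_inf => //; case: hB.
  by case: Bu => _; rewrite leNgt => /negP.
suff : r < r by rewrite ltxx.
rewrite (le_lt_trans rs)// (le_lt_trans _ q0r)//.
apply: main => // u /andP[/ltW u0 us]; apply/ltW; rewrite ltNge; apply/negP => ru.
have : s <= u.
  by apply: ge_inf; [case: hB | split=> //; rewrite u0 (le_trans (ltW us))].
by rewrite leNgt us.
Qed.

Lemma sq_norm_bounds (R : realType) (n : nat) (x : 'cV[R]_n) :
  `|x| ^+ 2 <= \sum_i x i 0 ^+ 2 <= n%:R * `|x| ^+ 2.
Proof.
have q0 : 0 <= \sum_i x i 0 ^+ 2 by apply: sumr_ge0 => i _; exact: sqr_ge0.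
apply/andP; split.
  rewrite -[leRHS]sqr_sqrtr// ler_sqr ?nnegrE ?sqrtr_ge0//.
  apply: norm_le_coord => [|i j]; first exact: sqrtr_ge0.
  rewrite ord1 -sqrtr_sqr ler_wsqrtr// (bigD1 i)//= lerDl sumr_ge0// => k _.
  exact: sqr_ge0.
rewrite mulr_natl -[leRHS](_ : \sum_(i < n) `|x| ^+ 2 = _); last first.
  by rewrite sumr_const card_ord.
apply: ler_sum => i _; rewrite -real_normK ?num_real//.
by rewrite ler_sqr ?nnegrE// coord_le_norm.
Qed.

(** Gronwall is applied to the sum of the squares of the coordinates, because the
    maximum norm is not differentiable along a solution. *)
Lemma solution_le_initial (R : realType) (n : nat) (f : 'cV[R]_n -> 'cV[R]_n)
    (K rho T : R) :
  0 <= K -> 0 < rho -> (forall x, `|x| < rho -> `|f x| <= K * `|x|) ->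
  exists C delta, [/\ 0 < C, 0 < delta &
    forall a b x, a < 0 -> T < b -> solution_on f a b x -> `|x 0| < delta ->
    forall t, 0 <= t <= T -> `|x t| < rho /\ `|x t| <= C * `|x 0|].
Proof.
move=> K0 rho0 fK; pose L := n%:R * 2 * K; pose C := n.+1%:R * expR (`|L * T|).
(* The Gronwall constant for |x|^2 is at most C <= C^2, which avoids a square
   root; the + 1 in C covers n = 0. *)
have C1 : 1 <= C.
  by rewrite -[1]mulr1 ler_pM// ?ler1n// -expR0 ler_expR.
have C0 : 0 < C by apply: lt_le_trans C1.
(* The factor 4 leaves room to keep q strictly below (rho / 2)^2 on [0, T]. *)
exists C, (rho / 4 / C); split => [||a b x a0 Tb xs x0d]//; first by rewrite !divr_gt0.
have qC : (\sum_i x 0 i 0 ^+ 2) * expR (L * T) <= (C * `|x 0|) ^+ 2.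
  have /andP[_ qn] := sq_norm_bounds (x 0).
  apply: (@le_trans _ _ (C * `|x 0| ^+ 2)); last first.
    rewrite exprMn; apply: (@ler_wpM2r R (`|x 0| ^+ 2)) => //.
    by rewrite expr2 ler_peMr// ltW.
  rewrite /C -[leRHS]mulrA [X in _ <= _ * X]mulrC mulrA ler_pM ?expR_ge0//.
  - by apply: sumr_ge0 => i _; exact: sqr_ge0.
  - rewrite (le_trans qn)//; apply: (@ler_wpM2r R (`|x 0| ^+ 2)) => //.
    by rewrite ler_nat.
  - by rewrite ler_expR ler_norm.
pose q t := \sum_i x t i 0 ^+ 2.
pose dq t := \sum_i 2 * x t i 0 * f (x t) i 0.
have qdq t : 0 <= t <= T -> is_derive t 1 q (dq t).
  move=> /andP[t0 tT].
  have xt : is_derive t 1 x (f (x t)).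
    by apply: xs; rewrite (lt_le_trans a0)// (le_lt_trans tT).
  rewrite (_ : q = \sum_i (fun t => x t i 0) ^+ 2); last first.
    by apply/funext => u; rewrite fct_sumE.
  apply: is_derive_sum => i; have xi := is_derive_coord i 0 xt.
  by apply: is_derive_eq; rewrite /GRing.scale/= expr1 mulr_natl mulr2n; ring.
have r0 : 0 < rho / 2 by rewrite divr_gt0.
have xq t c : 0 <= c -> q t <= c ^+ 2 -> `|x t| <= c.
  move=> c0 qc; rewrite -ler_sqr ?nnegrE//; apply: le_trans qc.
  by have /andP[] := sq_norm_bounds (x t).
have small : q 0 * expR (L * T) < (rho / 2) ^+ 2.
  apply: le_lt_trans qC _; rewrite ltr_sqr ?nnegrE ?mulr_ge0// ?ltW//.
  move: x0d; rewrite ltr_pdivlMr// mulrC => /lt_le_trans; apply.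
  by rewrite ler_pM2l// lef_pV2 ?posrE// ler_nat.
have qr t : q t < (rho / 2) ^+ 2 -> `|x t| < rho.
  move=> /ltW/xq -/(_ (ltW r0)) /le_lt_trans; apply.
  by rewrite ltr_pdivrMr// ltr_pMr// ltr1n.
have dqL t : 0 <= t <= T -> q t <= (rho / 2) ^+ 2 -> dq t <= L * q t.
  move=> tT /xq -/(_ (ltW r0)) xt.
  have {}xt : `|x t| < rho.
    by rewrite (le_lt_trans xt)// ltr_pdivrMr// ltr_pMr// ltr1n.
  have /andP[xq' _] := sq_norm_bounds (x t).
  apply: (@le_trans _ _ (\sum_(i < n) 2 * K * `|x t| ^+ 2)).
    apply: ler_sum => i _; rewrite -!mulrA ler_pM2l// (le_trans (ler_norm _))//.
    rewrite normrM (@le_trans _ _ (`|x t| * (K * `|x t|)))//.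
      by rewrite ler_pM ?coord_le_norm// (le_trans (coord_le_norm _ _ _))// fK.
    by rewrite mulrCA expr2.
  have -> : L * q t = n%:R * (2 * K * q t) by rewrite /L; ring.
  rewrite sumr_const card_ord -[leLHS]mulr_natl.
  by apply: ler_wpM2l => //; apply: ler_wpM2l => //; rewrite mulr_ge0.
have q0 t : 0 <= t <= T -> 0 <= q t.
  by move=> _; apply: sumr_ge0 => i _; exact: sqr_ge0.
have L0 : 0 <= L by rewrite !mulr_ge0.
move=> t tT; have [qt1 qt2] := le_expR_of_deriv_le_below L0 q0 qdq dqL small tT.
split; first exact: qr.
by apply: xq; [rewrite mulr_ge0// ltW | exact: le_trans qt1 qC].
Qed.

(** * A forced complex mode in real coordinates *)

(** This is z' = (alpha + i beta) z + f with z = a + i b and f = p + i s, and the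
    compared value is exp((alpha + i beta) t) z(0). In the rotating frame
    u + i v = exp(-(alpha + i beta) t) (a + i b) the derivative is the forcing
    term alone, so that u and v move by at most a multiple of m. *)
Lemma oscillator_duhamel (R : realType) (alpha beta T : R) : 0 <= T ->
  exists2 C, 0 <= C & forall (a b p s : R -> R) (m : R),
  (forall t : R, 0 <= t <= T -> is_derive t 1 a (alpha * a t - beta * b t + p t)) ->
  (forall t : R, 0 <= t <= T -> is_derive t 1 b (beta * a t + alpha * b t + s t)) ->
  (forall t : R, 0 <= t <= T -> `|p t| <= m) ->
  (forall t : R, 0 <= t <= T -> `|s t| <= m) ->
  forall t : R, 0 <= t <= T ->
  `|a t - expR (alpha * t) * (cos (beta * t) * a 0 - sin (beta * t) * b 0)|
    <= C * m /\
  `|b t - expR (alpha * t) * (cos (beta * t) * b 0 + sin (beta * t) * a 0)|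
    <= C * m.
Proof.
move=> T0; pose Q := expR (`|alpha| * T).
exists (4 * T * Q ^+ 2) => [|a b p s m ha hb hp hs t tT].
  by rewrite mulr_ge0 ?exprn_ge0 ?expR_ge0// mulr_ge0.
pose E := expR \o (fun t : R => - alpha * t).
pose Co := cos \o (fun t : R => beta * t).
pose Si := sin \o (fun t : R => beta * t).
have dlin (k u : R) : is_derive u 1 (fun u : R => k * u) k.
  by apply: (is_derive_eq (@is_deriveZ _ _ _ id k u 1 1 _)); rewrite /GRing.scale/= mulr1.
have dE (u : R) : is_derive u 1 E (- alpha * E u).
  have := dlin (- alpha) u => h; apply: is_derive_eq; rewrite /E/= /GRing.scale/=; ring.
have dC (u : R) : is_derive u 1 Co (- beta * Si u).
  have := dlin beta u => h; apply: is_derive_eq; rewrite /Si/= /GRing.scale/=; ring.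
have dS (u : R) : is_derive u 1 Si (beta * Co u).
  have := dlin beta u => h; apply: is_derive_eq; rewrite /Co/= /GRing.scale/=; ring.
pose u := E * (Co * a + Si * b); pose v := E * (Co * b - Si * a).
pose du (t : R) := E t * (Co t * p t + Si t * s t).
pose dv (t : R) := E t * (Co t * s t - Si t * p t).
have uP (r : R) : 0 <= r <= T -> is_derive r 1 u (du r).
  move=> rT; have da := ha r rT; have db := hb r rT.
  apply: (is_derive_eq (is_deriveM (dE r) (is_deriveD (is_deriveM (dC r) da)
    (is_deriveM (dS r) db)))).
  rewrite /du /GRing.scale/= !fctE/=; ring.
have vP (r : R) : 0 <= r <= T -> is_derive r 1 v (dv r).
  move=> rT; have da := ha r rT; have db := hb r rT.
  apply: (is_derive_eq (is_deriveM (dE r) (is_deriveB (is_deriveM (dC r) db)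
    (is_deriveM (dS r) da)))).
  rewrite /dv /GRing.scale/= !fctE/=; ring.
have EQ (k r : R) : `|k| <= `|alpha| -> 0 <= r <= T -> expR (k * r) <= Q.
  move=> kal /andP[r0 rT]; rewrite ler_expR (le_trans (ler_norm _))//.
  by rewrite normrM (ger0_norm r0) ler_pM.
have m0 : 0 <= m by rewrite (le_trans _ (hp 0 _)) ?lexx.
have bnd (w c d e1 e2 k : R) : `|w| <= Q -> `|c| <= 1 -> `|d| <= 1 ->
    `|e1| <= k -> `|e2| <= k -> `|w * (c * e1 + d * e2)| <= 2 * Q * k.
  move=> wQ c1 d1 e1k e2k; rewrite normrM mulrAC.
  rewrite mulrC ler_pM// (le_trans (ler_normD _ _))// !normrM mulr2n mulrDl mul1r.
  by rewrite lerD// -[leRHS]mul1r ler_pM.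
have Co1 r : `|Co r| <= 1 by rewrite ler_norml cos_geN1 cos_le1.
have Si1 r : `|Si r| <= 1 by rewrite ler_norml sin_geN1 sin_le1.
have EQ' r : 0 <= r <= T -> `|E r| <= Q.
  by move=> rT; rewrite ger0_norm ?expR_ge0// EQ ?normrN.
have ut : `|u t - u 0| <= T * (2 * Q * m).
  apply: (le_norm_increment uP) => // r rT.
  by apply: bnd => //; [exact: EQ'| exact: hp|exact: hs].
have vt : `|v t - v 0| <= T * (2 * Q * m).
  apply: (le_norm_increment vP) => // r rT; rewrite /dv -mulNr.
  by apply: bnd; rewrite ?normrN//; [exact: EQ'| exact: hs|exact: hp].
have u0 : u 0 = a 0.
  rewrite /u !fctE/= /E /Co /Si/= !mulr0 expR0 cos0 sin0.
  by rewrite mul0r !mul1r addr0.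
have v0 : v 0 = b 0.
  rewrite /v !fctE/= /E /Co /Si/= !mulr0 expR0 cos0 sin0.
  by rewrite mul0r !mul1r subr0.
have EE : expR (alpha * t) * E t = 1.
  by rewrite -expRD mulNr subrr expR0.
have CS : Co t ^+ 2 + Si t ^+ 2 = 1 by exact: cos2Dsin2.
have Ee : `|expR (alpha * t)| <= Q by rewrite ger0_norm ?expR_ge0// EQ.
have -> : 4 * T * Q ^+ 2 * m = 2 * Q * (T * (2 * Q * m)) by ring.
have ua : u t = E t * (Co t * a t + Si t * b t) by [].
have va : v t = E t * (Co t * b t - Si t * a t) by [].
split.
  rewrite (_ : _ - _ = expR (alpha * t) * (Co t * (u t - u 0) + - Si t * (v t - v 0))).
    by apply: bnd; rewrite ?normrN.
  rewrite u0 v0 ua va -[cos _]/(Co t) -[sin _]/(Si t).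
  transitivity (a t * (expR (alpha * t) * E t) * (Co t ^+ 2 + Si t ^+ 2)
    - expR (alpha * t) * (Co t * a 0 - Si t * b 0)); last by ring.
  by rewrite EE CS !mulr1.
rewrite (_ : _ - _ = expR (alpha * t) * (Co t * (v t - v 0) + Si t * (u t - u 0))).
  by apply: bnd; rewrite ?normrN.
rewrite u0 v0 ua va -[cos _]/(Co t) -[sin _]/(Si t).
transitivity (b t * (expR (alpha * t) * E t) * (Co t ^+ 2 + Si t ^+ 2)
  - expR (alpha * t) * (Co t * b 0 + Si t * a 0)); last by ring.
by rewrite EE CS !mulr1.
Qed.

(** * Real and imaginary parts of complex matrices *)

Lemma Re_is_additive (R : realType) : additive (@complex.Re R).
Proof. by case=> [a b] [c d]. Qed.

Lemma Im_is_additive (R : realType) : additive (@complex.Im R).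
Proof. by case=> [a b] [c d]. Qed.

HB.instance Definition _ (R : realType) :=
  GRing.isAdditive.Build R[i] R (@complex.Re R) (@Re_is_additive R).
HB.instance Definition _ (R : realType) :=
  GRing.isAdditive.Build R[i] R (@complex.Im R) (@Im_is_additive R).

Lemma re_mxM (R : realType) (m n q : nat) (B : 'M[R[i]]_(m, n)) (C : 'M[R[i]]_(n, q)) :
  re_mx (B *m C) = re_mx B *m re_mx C - im_mx B *m im_mx C.
Proof.
apply/matrixP => i j; rewrite !mxE raddf_sum -sumrB; apply: eq_bigr => k _.
by rewrite !mxE; case: (B i k) => [a b]; case: (C k j).
Qed.

Lemma im_mxM (R : realType) (m n q : nat) (B : 'M[R[i]]_(m, n)) (C : 'M[R[i]]_(n, q)) :
  im_mx (B *m C) = re_mx B *m im_mx C + im_mx B *m re_mx C.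
Proof.
apply/matrixP => i j; rewrite !mxE raddf_sum -big_split; apply: eq_bigr => k _.
by rewrite !mxE; case: (B i k) => [a b]; case: (C k j).
Qed.

Lemma re_cplx (R : realType) (m n : nat) (B : 'M[R]_(m, n)) : re_mx (cplx B) = B.
Proof. by apply/matrixP => i j; rewrite !mxE. Qed.

Lemma im_cplx (R : realType) (m n : nat) (B : 'M[R]_(m, n)) : im_mx (cplx B) = 0.
Proof. by apply/matrixP => i j; rewrite !mxE. Qed.

Lemma complex_mx_eq (R : realType) (m n : nat) (B C : 'M[R[i]]_(m, n)) :
  re_mx B = re_mx C -> im_mx B = im_mx C -> B = C.
Proof.
move=> /matrixP re /matrixP im; apply/matrixP => i j.
move: (re i j) (im i j); rewrite !mxE.
by case: (B i j) => a b; case: (C i j) => c d /= -> ->.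
Qed.

Definition conj_mx (R : realType) (m n : nat) (B : 'M[R[i]]_(m, n)) : 'M[R[i]]_(m, n) :=
  map_mx (@conjc R) B.

Lemma re_conj_mx (R : realType) (m n : nat) (B : 'M[R[i]]_(m, n)) :
  re_mx (conj_mx B) = re_mx B.
Proof. by apply/matrixP => i j; rewrite !mxE; case: (B i j). Qed.

Lemma im_conj_mx (R : realType) (m n : nat) (B : 'M[R[i]]_(m, n)) :
  im_mx (conj_mx B) = - im_mx B.
Proof. by apply/matrixP => i j; rewrite !mxE; case: (B i j). Qed.

Lemma conj_cplx (R : realType) (m n : nat) (B : 'M[R]_(m, n)) :
  conj_mx (cplx B) = cplx B.
Proof. by apply: complex_mx_eq; rewrite ?re_conj_mx// im_conj_mx im_cplx oppr0. Qed.

Lemma conj_mxM (R : realType) (m n q : nat) (B : 'M[R[i]]_(m, n)) (C : 'M[R[i]]_(n, q)) :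
  conj_mx (B *m C) = conj_mx B *m conj_mx C.
Proof. exact: map_mxM. Qed.

Lemma cplx_re_mx (R : realType) (m n : nat) (B : 'M[R[i]]_(m, n)) :
  conj_mx B = B -> cplx (re_mx B) = B.
Proof.
move=> BB; apply: complex_mx_eq; rewrite ?re_cplx ?im_cplx//.
have := im_conj_mx B; rewrite BB => /matrixP h; apply/matrixP => i j.
by move: (h i j); rewrite !mxE; lra.
Qed.

(** N is phi(A) for the function phi on the spectrum. Conjugation commutes with
    phi and maps an eigenvector of the real matrix A to an eigenvector for the
    conjugate eigenvalue, so conj(N) and N agree on the basis of the conjugated
    eigenvectors. *)
Lemma spectral_function_real (R : realType) (n : nat) (A : 'M[R]_n)
    (E : 'M[R[i]]_n) (lam : 'I_n -> R[i]) (phi : R[i] -> R[i]) :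
  E \in unitmx -> cplx A *m E = E *m diag_mx (\row_k lam k) ->
  (forall z, phi (conjc z) = conjc (phi z)) ->
  let N := E *m diag_mx (\row_k phi (lam k)) *m invmx E in conj_mx N = N.
Proof.
move=> Eu AE phiJ N.
have NE : N *m E = E *m diag_mx (\row_k phi (lam k)) by rewrite /N mulmxKV.
have [P EP] : exists P, E *m P = conj_mx E.
  by exists (invmx E *m conj_mx E); rewrite mulKVmx.
have EJu : conj_mx E \in unitmx by rewrite /conj_mx map_unitmx.
apply: (can_inj (mulmxK EJu)).
rewrite -conj_mxM NE conj_mxM -EP (mulmxA N) NE -!(mulmxA E); congr (_ *m _).
have LP : diag_mx (\row_k lam k) *m P = P *m conj_mx (diag_mx (\row_k lam k)).
  apply: (can_inj (mulKmx Eu)).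
  by rewrite !mulmxA -AE -(mulmxA _ E) EP -conj_mxM -AE conj_mxM conj_cplx.
rewrite /conj_mx map_diag_mx in LP *; rewrite map_diag_mx.
apply/matrixP => i j; have /matrixP/(_ i j) := LP.
rewrite !mul_diag_mx !mul_mx_diag !mxE /= => h; rewrite -phiJ.
have [->|Pij] := eqVneq (P i j) 0; first by rewrite mulr0 mul0r.
by rewrite mulrC; congr (phi _ * _); apply: (mulIf Pij); rewrite h mulrC.
Qed.

(** * Linearization of the flow at an equilibrium *)

Lemma fin_choice_ge0 (I : finType) (R : realType) (P : I -> R -> Prop) :
  (forall i, exists2 c, 0 <= c & P i c) ->
  exists2 f : I -> R, (forall i, 0 <= f i) & forall i, P i (f i).
Proof.
move=> h; exists (fun i => s2val (cid2 (h i))) => i.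
  exact: s2valP (cid2 (h i)).
exact: s2valP' (cid2 (h i)).
Qed.

(** Phi is e^(tA), built by diagonalization. In modal coordinates z = E^-1 x the
    equation splits into scalar equations with forcing E^-1 g(x(t)), which is
    O(|x(0)|^2) by the a priori bound on x. *)
Lemma flow_linearization (R : realType) (n : nat) (A : 'M[R]_n)
    (g : 'cV[R]_n -> 'cV[R]_n)
    (hg : g =O_ (nbhs (0 : 'cV[R]_n)) (fun x => `|x| ^+ 2 : R^o))
    (E : 'M[R[i]]_n) (lam : 'I_n -> R[i]) (T t : R) :
  E \in unitmx -> cplx A *m E = E *m diag_mx (\row_k lam k) ->
  0 <= t <= T ->
  exists Phi : 'M[R]_n,
    cplx Phi *m E = E *m diag_mx (\row_k cexp (t%:C%C * lam k)) /\
    exists C delta, [/\ 0 <= C, 0 < delta & forall a b x, a < 0 -> T < b ->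
      solution_on (fun x => A *m x + g x) a b x -> `|x 0| < delta ->
      `|x t - Phi *m x 0| <= C * `|x 0| ^+ 2].
Proof.
move=> Eu AE tT.
pose D := diag_mx (\row_k cexp (t%:C%C * lam k)); pose Y := invmx E.
pose Phi := re_mx (E *m D *m Y).
have PhiE : cplx Phi = E *m D *m Y.
  apply: cplx_re_mx.
  apply: (spectral_function_real (phi := fun z => cexp (t%:C%C * z)) Eu AE).
  case=> a b; rewrite /cexp/= !mul0r; apply/eqP; rewrite eq_complex/=.
  rewrite !subr0 !addr0 mulrN cosN sinN mulrN.
  by rewrite !eqxx.
exists Phi; split; first by rewrite PhiE /Y mulmxKV.
have [Cg Cg0 gC] : exists2 Cg, 0 < Cg &
    \forall x \near (0 : 'cV[R]_n), `|g x| <= Cg * `|x| ^+ 2.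
  have /eqO_exP[k k0 hk] := hg; exists k => //.
  by apply: filterS hk => x; rewrite [X in _ * X]ger0_norm// exprn_ge0.

have [rho rho0 grho] : exists2 rho, 0 < rho &
    forall x, `|x| < rho -> `|g x| <= Cg * `|x| ^+ 2.
  have /nbhs_ballP[r/= r0 rg] := gC; exists r => // x xr; apply: rg.
  by rewrite -ball_normE/= sub0r normrN.
have [kA kA0 Alip] := mulmx_lipschitz A.
have [|||C1 [d1 [C10 d10 xC]]] := @solution_le_initial _ _ (fun x => A *m x + g x)
    (kA + Cg) (Num.min rho 1) T.
- by rewrite addr_ge0// ltW.
- by rewrite lt_min rho0 ltr01.
- move=> x; rewrite lt_min => /andP[xrho x1].
  rewrite (le_trans (ler_normD _ _))// mulrDl lerD// (le_trans (grho _ xrho))//.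
  by apply: ler_wpM2l; rewrite ?expr2 ?ler_piMl// ltW.
have T0 : 0 <= T by case/andP: tT => /le_trans; apply.
have [Ck Ck0 oscC] := fin_choice_ge0 (fun k =>
  oscillator_duhamel (complex.Re (lam k)) (complex.Im (lam k)) T0).
have [k1 k10 Yr] := mulmx_lipschitz (re_mx Y).
have [k2 k20 Yi] := mulmx_lipschitz (im_mx Y).
have [k3 k30 Er] := mulmx_lipschitz (re_mx E).
have [k4 k40 Ei] := mulmx_lipschitz (im_mx E).
pose kY := k1 + k2; pose Cs := \sum_k Ck k.
have Cs0 : 0 <= Cs by exact: sumr_ge0.
have kY0 : 0 < kY by rewrite addr_gt0.
exists ((k3 + k4) * (Cs * (kY * (Cg * C1 ^+ 2)))), d1; split => //.
  by rewrite !mulr_ge0 ?addr_ge0 ?exprn_ge0// ltW.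
move=> a b x a0 Tb xs x0d.
have xb := xC a b x a0 Tb xs x0d.
pose m := kY * (Cg * (C1 * `|x 0|) ^+ 2).
have gm s : 0 <= s <= T -> `|g (x s)| <= Cg * (C1 * `|x 0|) ^+ 2.
  move=> /xb[]; rewrite lt_min => /andP[/grho gs _] xs0.
  rewrite (le_trans gs)//; apply: ler_wpM2l; first exact: ltW.
  by rewrite ler_sqr ?nnegrE// mulr_ge0// ltW.
have gm0 : 0 <= Cg * (C1 * `|x 0|) ^+ 2 by rewrite mulr_ge0 ?sqr_ge0// ltW.
have bndY (B : 'M[R]_n) kB k s : kB <= kY -> (forall y : 'cV_n, `|B *m y| <= kB * `|y|) ->
    0 <= s <= T -> `|(B *m g (x s)) k 0| <= m.
  move=> kBY Blip sT; rewrite (le_trans (coord_le_norm _ _ _))// (le_trans (Blip _))//.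
  rewrite (@le_trans _ _ (kY * `|g (x s)|)) ?ler_wpM2r// ler_wpM2l ?gm//.
  exact: ltW.
have dx s : 0 <= s <= T -> is_derive s 1 x (A *m x s + g (x s)).
  by move=> /andP[s0 sT]; apply: xs; rewrite (lt_le_trans a0)//= (le_lt_trans sT).
have YA : Y *m cplx A = diag_mx (\row_k lam k) *m Y.
  by apply: (can_inj (mulmxK Eu)); rewrite -mulmxA AE mulmxA /Y mulVmx// mul1mx mulmxKV.
pose w := Y *m cplx (x t) - D *m (Y *m cplx (x 0)).
(* w collects the modal errors z_k(t) - exp(lambda_k t) z_k(0). *)
have wE : x t - Phi *m x 0 = re_mx E *m re_mx w - im_mx E *m im_mx w.
  rewrite -re_mxM /w mulmxBr mulKVmx// !mulmxA -PhiE.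
  by rewrite /cplx -map_mxM -map_mxB; apply/esym/re_cplx.
have Dk k : cexp (t%:C%C * lam k) = Complex
    (expR (complex.Re (lam k) * t) * cos (complex.Im (lam k) * t))
    (expR (complex.Re (lam k) * t) * sin (complex.Im (lam k) * t)).
  by case: (lam k) => al be /=; rewrite !mul0r subr0 addr0 ![t * _]mulrC.
have YrA : re_mx Y *m A = diag_mx (\row_k complex.Re (lam k)) *m re_mx Y
    - diag_mx (\row_k complex.Im (lam k)) *m im_mx Y.
  have := congr1 (@re_mx R n n) YA.
  rewrite !re_mxM re_cplx im_cplx mulmx0 subr0 => ->; congr (_ - _); congr (_ *m _).
    by apply/matrixP => i j; rewrite !mxE raddfMn.
  by apply/matrixP => i j; rewrite !mxE raddfMn.
have YiA : im_mx Y *m A = diag_mx (\row_k complex.Im (lam k)) *m re_mx Y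
    + diag_mx (\row_k complex.Re (lam k)) *m im_mx Y.
  have := congr1 (@im_mx R n n) YA.
  rewrite !im_mxM re_cplx im_cplx mulmx0 add0r addrC => ->; congr (_ + _); congr (_ *m _).
    by apply/matrixP => i j; rewrite !mxE raddfMn.
  by apply/matrixP => i j; rewrite !mxE raddfMn.
have wb k : `|re_mx w k 0| <= Ck k * m /\ `|im_mx w k 0| <= Ck k * m.
  have := oscC k (fun s => (re_mx Y *m x s) k 0) (fun s => (im_mx Y *m x s) k 0)
    (fun s => (re_mx Y *m g (x s)) k 0) (fun s => (im_mx Y *m g (x s)) k 0) m.
  case/(_ _ _ _ _ t tT).
  - move=> s sT.
    have dY := is_derive_coord k 0 (is_derive_mulmx (re_mx Y) (dx s sT)).
    apply: is_derive_eq dY _.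
    by rewrite mulmxDr mulmxA YrA mulmxBl -!mulmxA !mul_diag_mx !mxE.
  - move=> s sT.
    have dY := is_derive_coord k 0 (is_derive_mulmx (im_mx Y) (dx s sT)).
    apply: is_derive_eq dY _.
    by rewrite mulmxDr mulmxA YiA mulmxDl -!mulmxA !mul_diag_mx !mxE.
  - by move=> s; apply: (bndY _ k1) => //; rewrite lerDl ltW.
  - by move=> s; apply: (bndY _ k2) => //; rewrite lerDr ltW.
  have reD : re_mx D = diag_mx (\row_k
      (expR (complex.Re (lam k) * t) * cos (complex.Im (lam k) * t))).
    by apply/matrixP => i j; rewrite !mxE raddfMn Dk.
  have imD : im_mx D = diag_mx (\row_k
      (expR (complex.Re (lam k) * t) * sin (complex.Im (lam k) * t))).
    by apply/matrixP => i j; rewrite !mxE raddfMn Dk.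
  have YR s : re_mx (Y *m cplx (x s)) = re_mx Y *m x s.
    by rewrite re_mxM re_cplx im_cplx mulmx0 subr0.
  have YI s : im_mx (Y *m cplx (x s)) = im_mx Y *m x s.
    by rewrite im_mxM re_cplx im_cplx mulmx0 add0r.
  have -> : re_mx w = re_mx Y *m x t
      - (re_mx D *m (re_mx Y *m x 0) - im_mx D *m (im_mx Y *m x 0)).
    by rewrite /w {1}/re_mx map_mxB -!/(re_mx _) YR re_mxM YR YI.
  have -> : im_mx w = im_mx Y *m x t
      - (re_mx D *m (im_mx Y *m x 0) + im_mx D *m (re_mx Y *m x 0)).
    by rewrite /w {1}/im_mx map_mxB -!/(im_mx _) YI im_mxM YR YI.
  rewrite reD imD !mul_diag_mx.
  move: (re_mx Y *m x t) (im_mx Y *m x t) (re_mx Y *m x 0) (im_mx Y *m x 0).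
  by move=> at_ bt a0' b0'; rewrite !mxE mulrBr mulrDr !mulrA.
have wn (v : 'cV[R]_n) : (forall k, `|v k 0| <= Ck k * m) -> `|v| <= Cs * m.
  move=> vk; apply: norm_le_coord => [|i j]; first by rewrite mulr_ge0// mulr_ge0// ltW.
  rewrite ord1 (le_trans (vk i))// ler_wpM2r//; first by rewrite mulr_ge0// ltW.
  by rewrite /Cs (bigD1 i)//= lerDl sumr_ge0.
have -> : (k3 + k4) * (Cs * (kY * (Cg * C1 ^+ 2))) * `|x 0| ^+ 2 =
    k3 * (Cs * m) + k4 * (Cs * m).
  by rewrite /m; ring.
rewrite wE (le_trans (ler_normB _ _))// lerD//.
  by rewrite (le_trans (Er _))// ler_pM2l// wn// => k; have [] := wb k.
by rewrite (le_trans (Ei _))// ler_pM2l// wn// => k; have [] := wb k.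
Qed.

(** * Local estimates for differentiable maps *)

Lemma diff_estimate (R : realType) (V W : normedModType R) (f : V -> W) (x : V)
    (eps : R) : differentiable f x -> 0 < eps ->
  \forall y \near x, `|f y - f x - 'd f x (y - x)| <= eps * `|y - x|.
Proof.
move=> df e0; have /diff_locally/eqaddoP/(_ _ e0) := df.
rewrite /= => near0; rewrite (near_shift 0)/= subr0.
by apply: filterS near0 => h /=; rewrite addrK /shift/= opprD addrA.
Qed.

Lemma diff_lipschitz_at (R : realType) (V W : normedModType R) (f : V -> W) (x : V) :
  differentiable f x ->
  exists2 k, 0 < k & \forall y \near x, `|f y - f x| <= k * `|y - x|.
Proof.
move=> df; have [k k0 dk] := linear_lipschitz (diff_continuous df).
exists (1 + k); first by rewrite addr_gt0.
apply: filterS (diff_estimate df ltr01) => y fy.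
rewrite -[f y - f x](subrK ('d f x (y - x))) (le_trans (ler_normD _ _))//.
by rewrite mulrDl lerD.
Qed.

(** Locked, so that the differentials of f at different points are never compared
    by unfolding. *)
HB.lock Definition diff_mx (R : realType) (n p : nat) (f : 'cV[R]_n -> 'cV[R]_p)
    (x : 'cV[R]_n) : 'M[R]_(p, n) :=
  \matrix_(i, j) ('d f x (delta_mx j 0)) i 0.

Lemma diff_mxE (R : realType) (n p : nat) (f : 'cV[R]_n -> 'cV[R]_p)
    (x v : 'cV[R]_n) : 'd f x v = diff_mx f x *m v.
Proof.
rewrite unlock; apply/matrixP => i j; rewrite ord1 mxE.
rewrite {1}(matrix_sum_delta v) linear_sum summxE.
apply: eq_bigr => k _; rewrite big_ord1 linearZ !mxE mulrC.
by congr (_ * _).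
Qed.

Lemma is_derive_comp_mx (R : realType) (n p : nat) (f : 'cV[R]_n -> 'cV[R]_p)
    (x : R -> 'cV[R]_n) (y : 'cV[R]_n) (t : R) v : x t = y -> differentiable f y ->
  is_derive t 1 x v -> is_derive t 1 (f \o x) (diff_mx f y *m v).
Proof. by move=> <- df dx; rewrite -diff_mxE; exact: is_derive_comp1. Qed.

(** The directional derivatives along the basis vectors are continuous and finite
    in number, so the differential is continuous for the operator norm. *)
Lemma C1_diff_continuous (R : realType) (n p : nat) (h : 'cV[R]_n -> 'cV[R]_p)
    (U : set 'cV[R]_n) (x : 'cV[R]_n) (eps : R) :
  open U -> U x -> Ck_on 1 U h -> 0 < eps ->
  \forall y \near x, forall v : 'cV[R]_n,
    `|diff_mx h y *m v - diff_mx h x *m v| <= eps * `|v|.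
Proof.
move=> oU Ux [dh ch] e0.
have nU : \forall y \near x, U y by exact: open_nbhs_nbhs.
have dcol (j : 'I_n) : \forall y \near x, forall i,
    `|diff_mx h y i j - diff_mx h x i j| <= eps / n.+1%:R.
  have dhE z : U z -> 'D_(delta_mx j 0) h z = col j (diff_mx h z).
    by move=> Uz; rewrite colE -diff_mxE; apply/deriveE/dh.
  have := ch (delta_mx j 0) x Ux.
  move=> /(@cvgrPdist_le _ _ _ (nbhs x) (nbhs_filter x))/(_ (eps / n.+1%:R)).
  rewrite divr_gt0// => /(_ isT) near1.
  near=> y => i.
  have Uy : U y by near: y.
  have : `|'D_(delta_mx j 0) h x - 'D_(delta_mx j 0) h y| <= eps / n.+1%:R.
    by near: y.
  rewrite (dhE y Uy) (dhE x Ux) distrC; apply: le_trans.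
  by rewrite -linearB/=; apply: le_trans (coord_le_norm _ i 0); rewrite !mxE.
have dall := filter_forall (nbhs_filter x) dcol.
apply: filterS dall => y hy v; rewrite -mulmxBl.
apply: norm_le_coord => [|i k]; first by rewrite mulr_ge0// ltW.
rewrite ord1 mxE (le_trans (ler_norm_sum _ _ _))//.
apply: (@le_trans _ _ (\sum_(i < n) eps / n.+1%:R * `|v|)).
  apply: ler_sum => j _; rewrite normrM ler_pM ?coord_le_norm//.
  by rewrite !mxE; exact: hy.
rewrite sumr_const card_ord -[leLHS]mulr_natr mulrAC ler_wpM2r//.
by rewrite -mulrA ger_pMr// mulrC ler_pdivrMr// mul1r ler_nat.
Unshelve. all: by end_near. Qed.

(** * Curves and tangent vectors of subsets *)

(** The data provided at a point by [C1_on], kept together with the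
    neighbourhood: the same h computes the derivatives of f at all the points of
    A in U, which is what makes these derivatives depend continuously on the
    point. *)
Definition C1_extends (R : realType) (V W : normedModType R) (A : set V)
    (f : V -> W) (U : set V) (h : V -> W) : Prop :=
  [/\ open U, Ck_on 1 U h & forall y, A y -> U y -> h y = f y].

Lemma curve_continuous (R : realType) (n : nat) (M : set 'cV[R]_n) x v gam
    (U : set 'cV[R]_n) :
  curve_in M x v gam -> nbhs x U -> \forall t \near (0 : R), U (gam t).
Proof.
by move=> [g0 _ dg] Ux; have := is_derive_continuous dg; apply; rewrite g0.
Qed.

Lemma curve_diff (R : realType) (n p : nat) (M : set 'cV[R]_n)
    (f h : 'cV[R]_n -> 'cV[R]_p) U x v gam :
  C1_extends M f U h -> U x -> curve_in M x v gam ->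
  is_derive (0 : R) (1 : R) (f \o gam) (diff_mx h x *m v).
Proof.
move=> [oU [dh _] hf] Ux cg; have [g0 gM dg] := cg.
have nU := curve_continuous cg (open_nbhs_nbhs (conj oU Ux)).
apply: (@near_eq_is_derive _ _ _ (h \o gam)).
  by near=> t; apply: hf; near: t.
by apply: is_derive_comp_mx => //; exact: dh.
Unshelve. all: by end_near. Qed.

(** The derivative along a curve does not depend on the choice of the curve,
    since it is computed by the extension h. *)
Lemma mdiff_eq (R : realType) (n p : nat) (M : set 'cV[R]_n)
    (f h : 'cV[R]_n -> 'cV[R]_p) U x v :
  C1_extends M f U h -> U x -> tangent M x v -> mdiff M f x v = diff_mx h x *m v.
Proof.
move=> ext Ux [gam cg]; rewrite /mdiff; apply: xget_unique.
  by exists gam; split => //; exact: (curve_diff ext Ux cg).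
move=> w [gam' [cg' [_ <-]]].
by have [_ ->] := curve_diff ext Ux cg'.
Qed.

Lemma curve_image (R : realType) (n p : nat) (M : set 'cV[R]_n)
    (f h : 'cV[R]_n -> 'cV[R]_p) U x v gam :
  C1_extends M f U h -> U x -> curve_in M x v gam ->
  curve_in (f @` M) (f x) (diff_mx h x *m v) (f \o gam).
Proof.
move=> ext Ux cg; have [g0 gM dg] := cg; split; first by rewrite /= g0.
  by apply: filterS gM => t Mt; exists (gam t).
exact: (curve_diff ext Ux cg).
Qed.

Lemma tangent_image (R : realType) (n p : nat) (M : set 'cV[R]_n)
    (f h : 'cV[R]_n -> 'cV[R]_p) U x v :
  C1_extends M f U h -> U x -> tangent M x v -> tangent (f @` M) (f x) (diff_mx h x *m v).
Proof. by move=> ext Ux [gam /(curve_image ext Ux)]; eexists; eassumption. Qed.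

Lemma tangent0 (R : realType) (n : nat) (M : set 'cV[R]_n) x : M x -> tangent M x 0.
Proof.
by move=> Mx; exists (cst x); split; [by []|by apply: filterE|exact: is_derive_cst].
Qed.

Lemma tangentN (R : realType) (n : nat) (M : set 'cV[R]_n) x v :
  tangent M x v -> tangent M x (- v).
Proof.
move=> [gam [g0 gM dg]]; exists (gam \o -%R); split; first by rewrite /= oppr0.
  have cN : {for (0 : R), continuous (-%R : R -> R)} by exact: opp_continuous.
  have : nbhs (- (0 : R)) [set t | M (gam t)] by rewrite oppr0.
  exact: cN.
have dg' : is_derive (- (0 : R)) (1 : R) gam v by rewrite oppr0.
have [/derivable1_diffP dgam <-] := dg'.
have dN : is_derive (0 : R) (1 : R) (-%R : R -> R) (- 1) by exact: is_deriveNid.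
apply: is_derive_eq (is_derive_comp1 dgam dN) _.
by rewrite linearN deriveE.
Qed.

(** Through a chart phi at x, a point y of M is phi(w) with
    y - x = Dphi(w0) (w - w0) + o(|w - w0|). The first term is tangent, hence
    killed by N, and |w - w0| = O(|y - x|) because the inverse chart is C^1. *)
Lemma tangent_approx (R : realType) (n d q : nat) (M : set 'cV[R]_n)
    (x : 'cV[R]_n) (N : 'M[R]_(q, n)) (eps : R) :
  submanifold d M -> M x -> (forall v, tangent M x v -> N *m v = 0) -> 0 < eps ->
  \forall y \near x, M y -> `|N *m (y - x)| <= eps * `|y - x|.
Proof.
move=> sM Mx NT e0.
have [U [W [phi [psi [[oU Ux] oW [[dphi _] cpsi] phiW psiphi]]]]] := sM x Mx.
have MUx : (M `&` U) x by [].
have [w0 Ww0 phiw0] : (phi @` W) x by rewrite phiW.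
have [U' [h [oU' U'x [dh _] hpsi]]] := cpsi x MUx.
(* h is a differentiable extension of the inverse chart. *)
have hx : h x = w0 by rewrite hpsi// -phiw0 psiphi.
have [k k0 hlip] := diff_lipschitz_at (dh x U'x).
have [kN kN0 Nlip] := mulmx_lipschitz N.
have eps' : 0 < eps / (kN * k) by rewrite divr_gt0// mulr_gt0.
pose P := diff_mx phi w0.
have est : \forall w \near w0,
    `|phi w - phi w0 - P *m (w - w0)| <= eps / (kN * k) * `|w - w0|.
  by apply: filterS (diff_estimate (dphi w0 Ww0) eps') => w; rewrite diff_mxE.
have hcont : {for x, continuous h} by exact: differentiable_continuous (dh x U'x).
have NTphi (u : 'cV[R]_d) : N *m (P *m u) = 0.
  apply: NT; exists (fun t : R => phi (w0 + t *: u)).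
  have dl : is_derive (0 : R) (1 : R) (fun t : R => w0 + t *: u) u.
    have ds := is_diff_scalel (0 : R) u.
    have d1 : is_derive (0 : R) (1 : R) (fun t : R => t *: u) u.
      apply: DeriveDef; first by apply/derivable1_diffP/ex_diff.
      by rewrite deriveE ?diff_val ?scale1r.
    by apply: is_derive_eq (is_deriveD (is_derive_cst w0 _ _) d1) _; rewrite add0r.
  split; first by rewrite scale0r addr0.
    have : \forall t \near (0 : R), W (w0 + t *: u).
      have := is_derive_continuous dl; apply.
      by rewrite scale0r addr0; exact: open_nbhs_nbhs.
    apply: filterS => t Wt.
    have : (phi @` W) (phi (w0 + t *: u)) by exists (w0 + t *: u).
    by rewrite phiW => -[].
  by apply: (is_derive_comp_mx _ (dphi w0 Ww0) dl); rewrite scale0r addr0.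
have esth : \forall y \near x,
    `|phi (h y) - phi w0 - P *m (h y - w0)| <= eps / (kN * k) * `|h y - w0|.
  have esth' : nbhs (h x)
    [set w | `|phi w - phi w0 - P *m (w - w0)| <= eps / (kN * k) * `|w - w0|].
    by rewrite hx.
  exact: (hcont _ esth').
near=> y => My.
have Uy : U y by near: y; exact: open_nbhs_nbhs.
have U'y : U' y by near: y; exact: open_nbhs_nbhs.
have [w Ww phiw] : (phi @` W) y by rewrite phiW.
have hy : h y = w by rewrite hpsi// -phiw psiphi.
have -> : N *m (y - x) = N *m (phi (h y) - phi w0 - P *m (h y - w0)).
  by rewrite [in RHS]mulmxBr NTphi subr0 hy phiw phiw0.
rewrite (le_trans (Nlip _))//.
have yest : `|phi (h y) - phi w0 - P *m (h y - w0)| <= eps / (kN * k) * `|h y - w0|.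
  by near: y.
have ylip : `|h y - w0| <= k * `|y - x| by rewrite -hx; near: y.
apply: (@le_trans _ _ (kN * (eps / (kN * k) * (k * `|y - x|)))).
  rewrite ler_pM2l// (le_trans yest)// ler_pM2l//.
by rewrite le_eqVlt; apply/orP; left; apply/eqP; field; rewrite !gt_eqF.
Unshelve. all: by end_near. Qed.

(** * The matrix V Lambda V^+ *)

Lemma conj_ctrmx (R : realType) (m n : nat) (B : 'M[R[i]]_(m, n)) :
  ctrmx B = conj_mx B^T.
Proof. by []. Qed.

Lemma conj_mxK (R : realType) (m n : nat) (B : 'M[R[i]]_(m, n)) :
  conj_mx (conj_mx B) = B.
Proof. by apply/matrixP => i j; rewrite !mxE conjcK. Qed.

Lemma ctrmx_conj (R : realType) (m n : nat) (B : 'M[R[i]]_(m, n)) :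
  ctrmx (conj_mx B) = conj_mx (ctrmx B).
Proof. by rewrite !conj_ctrmx; congr conj_mx; rewrite /conj_mx map_trmx. Qed.

Lemma mppinv_left_inverse (C : numClosedFieldType) (m n : nat)
    (V : 'M[C]_(m, n)) (X : 'M[C]_(n, m)) :
  X *m V = 1%:M -> mppinv V *m V = 1%:M.
Proof.
move=> XV; have [VVV _ _ _] := mppinvP V.
transitivity (X *m (V *m mppinv V *m V)); last by rewrite VVV.
by rewrite -(mulmxA V) (mulmxA _ V) XV mul1mx.
Qed.

(** The hypothesis says that the range of V is stable under conjugation. Then the
    orthogonal projector V V^+ on that range and its conjugate have the same
    range, so each of them fixes the other, and two Hermitian idempotents with
    this property coincide. *)
Lemma range_projector_real (R : realType) (m n : nat)
    (V : 'M[R[i]]_(m, n)) (Q : 'M[R[i]]_n) :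
  conj_mx V = V *m Q -> conj_mx (V *m mppinv V) = V *m mppinv V.
Proof.
move=> VQ; have [VVV _ Vherm _] := mppinvP V.
pose Pr := V *m mppinv V.
have PrJ : Pr *m conj_mx Pr = conj_mx Pr.
  by rewrite {2 3}/Pr conj_mxM mulmxA VQ mulmxA VVV.
have JPr : conj_mx Pr *m Pr = Pr.
  by rewrite -{2}(conj_mxK Pr) -conj_mxM PrJ conj_mxK.
have Prherm : ctrmx Pr = Pr by [].
by rewrite -/Pr -PrJ -[RHS]Prherm -[in RHS]JPr ctrmxM ctrmx_conj Prherm.
Qed.

Lemma reduced_matrix_intertwines (R : realType) (n d p : nat)
    (H : 'M[R]_(p, n)) (A : 'M[R]_n) (E : 'M[R[i]]_(n, d)) (V : 'M[R[i]]_(p, d))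
    (c lam : 'rV[R[i]]_d) :
  cplx H *m E = V *m diag_mx c -> cplx A *m E = E *m diag_mx lam ->
  mppinv V *m V = 1%:M ->
  cplx H *m (cplx A *m E) = V *m diag_mx lam *m mppinv V *m (cplx H *m E).
Proof.
move=> HE AE VV; rewrite AE mulmxA HE -!mulmxA (mulmxA (mppinv V)) VV mul1mx.
by congr (_ *m _); exact: diag_mxC.
Qed.

(** B and conj(B) agree on the conjugated columns of V, which are multiples of
    the vectors H conj(e_k): both send H conj(e_k) to H A conj(e_k). These columns
    span the range of V, so composing with the real projector V V^+ gives the
    equality of B and conj(B). *)
Lemma reduced_matrix_real (R : realType) (n d p : nat)
    (H : 'M[R]_(p, n)) (A : 'M[R]_n) (E : 'M[R[i]]_(n, d)) (V : 'M[R[i]]_(p, d))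
    (c lam : 'rV[R[i]]_d) (P : 'M[R[i]]_d) :
  cplx H *m E = V *m diag_mx c -> (forall k, c 0 k != 0) ->
  cplx A *m E = E *m diag_mx lam -> conj_mx E = E *m P ->
  mppinv V *m V = 1%:M ->
  conj_mx (V *m diag_mx lam *m mppinv V) = V *m diag_mx lam *m mppinv V.
Proof.
move=> HE c0 AE EP VV; set B := V *m diag_mx lam *m mppinv V.
have inter : cplx H *m (cplx A *m E) = B *m (cplx H *m E).
  exact: reduced_matrix_intertwines HE AE VV.
pose Dc := conj_mx (diag_mx c); pose Vj := conj_mx V.
have Dcu : Dc \in unitmx.
  rewrite /Dc /conj_mx map_unitmx unitmxE det_diag unitfE prodf_seq_neq0.
  by apply/allP => k _ /=; exact: c0.
have VjH : Vj *m Dc = cplx H *m (E *m P).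
  by rewrite -EP -conj_mxM -HE conj_mxM conj_cplx.
have VjQ : conj_mx V = V *m (diag_mx c *m P *m invmx Dc).
  by apply: (can_inj (mulmxK Dcu)); rewrite VjH !mulmxA mulmxKV// HE.
(* Both sides, times conj(c), are the image under H of the conjugated A E. *)
have BVj : B *m Vj = conj_mx B *m Vj.
  apply: (can_inj (mulmxK Dcu)); rewrite -(mulmxA B) -(mulmxA (conj_mx B)).
  transitivity (conj_mx (B *m (cplx H *m E))); last by rewrite conj_mxM HE conj_mxM.
  rewrite -inter !conj_mxM !conj_cplx EP VjH.
  by rewrite (mulmxA (cplx H)) (mulmxA B) -inter !mulmxA.
have BPr : B *m (V *m mppinv V) = B.
  by rewrite /B -!mulmxA (mulmxA (mppinv V) V) VV mul1mx.
rewrite -{1}BPr conj_mxM conj_mxM mulmxA -BVj -(mulmxA B) -conj_mxM.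
by rewrite (range_projector_real VjQ).
Qed.

(** * Matrices that are small along a subset *)

(** Along a curve gam with velocity v one has B (gam t - y0) = t B v + o(t), and
    the hypothesis makes the left-hand side o(t). *)
Lemma tangent_kernel (R : realType) (p q : nat) (N : set 'cV[R]_p) (y0 v : 'cV[R]_p)
    (B : 'M[R]_(q, p)) :
  (forall eps, 0 < eps ->
     \forall y \near within N (nbhs y0), `|B *m (y - y0)| <= eps * `|y - y0|) ->
  tangent N y0 v -> B *m v = 0.
Proof.
move=> Bo [gam cg]; have [g0 gN dg] := cg.
have dgam : differentiable gam (0 : R) by apply/derivable1_diffP; case: dg.
have [k k0 glip] := diff_lipschitz_at dgam.
have dBg := is_derive_mulmx B dg.
have dB : differentiable (fun s : R => B *m gam s) (0 : R).
  by apply/derivable1_diffP; case: dBg.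
apply/eqP; rewrite -normr_eq0; apply/eqP/le_anti; rewrite normr_ge0 andbT.
apply/ler_addgt0Pr => e e0; rewrite add0r.
have e'0 : 0 < e / (1 + k) by rewrite divr_gt0// addr_gt0.
have gB : \forall t \near (0 : R), `|B *m (gam t - y0)| <= e / (1 + k) * `|gam t - y0|.
  have near1 := curve_continuous cg (Bo _ e'0).
  by near=> t; apply: (near near1 t) => //; near: t.
have est := diff_estimate dB e'0.
have [t t0 [t1 t2 t3]] : exists2 t : R, 0 < t &
  [/\ `|B *m (gam t - y0)| <= e / (1 + k) * `|gam t - y0|,
      `|gam t - gam 0| <= k * `|t - 0| &
      `|B *m gam t - B *m gam 0 - 'd (fun s : R => B *m gam s) (0 : R) (t - 0)|
       <= e / (1 + k) * `|t - 0|].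
  have [r /= r0 rP] := (nbhs_ballP _ _).1 (filterI gB (filterI glip est)).
  exists (r / 2); first by rewrite divr_gt0.
  have [] := rP (r / 2).
    rewrite /ball/= sub0r normrN gtr0_norm ?divr_gt0//.
    by rewrite ltr_pdivrMr// ltr_pMr// ltr1n.
  by move=> h1 [h2 h3].
have dE : 'd (fun s : R => B *m gam s) (0 : R) t = t *: (B *m v).
  rewrite -[t in LHS]mulr1 -[t * 1]/(t *: (1 : R)) linearZ -deriveE//.
  by case: dBg => _ ->.
move: t2 t3; rewrite subr0 dE g0 -mulmxBr (gtr0_norm t0) => t2 t3.
rewrite -(ler_pM2l t0) -{1}(gtr0_norm t0) -normrZ.
rewrite -[t *: _](subKr (B *m (gam t - y0))) (le_trans (ler_normB _ _))//.
apply: (@le_trans _ _ (e / (1 + k) * (k * t) + e / (1 + k) * t)).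
  by rewrite lerD// (le_trans t1)// ler_pM2l.
rewrite le_eqVlt; apply/orP; left; apply/eqP; field.
by rewrite gt_eqF// addr_gt0.
Unshelve. all: by end_near. Qed.

(** * The derivative of the delay map at the fixed point *)

Lemma diff_of_quadratic_error (R : realType) (n m : nat)
    (f : 'cV[R]_n -> 'cV[R]_m) (Phi : 'M[R]_(m, n)) (C : R) : 0 <= C ->
  (\forall x \near (0 : 'cV[R]_n), `|f x - Phi *m x| <= C * `|x| ^+ 2) ->
  [/\ f 0 = 0, differentiable f 0 & diff_mx f 0 = Phi].
Proof.
move=> C0 fPhi.
have f0 : f 0 = 0.
  have := nbhs_singleton fPhi; rewrite mulmx0 subr0 normr0 expr0n/= mulr0.
  by rewrite normr_le0 => /eqP.
have approx : f \o shift 0 =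
    cst (f 0) + (mulmx Phi : 'cV[R]_n -> 'cV[R]_m) +o_ (0 : 'cV[R]_n) id.
  apply/eqaddoP => eps e0.
  have e'0 : 0 < eps / (C + 1) by rewrite divr_gt0// ltr_wpDl.
  have small : \forall x \near (0 : 'cV[R]_n), `|x| <= eps / (C + 1).
    apply/nbhs_ballP; exists (eps / (C + 1)) => //= x.
    by rewrite -ball_normE/= sub0r normrN => /ltW.
  near=> x; have xsmall : `|x| <= eps / (C + 1) by near: x.
  rewrite !fctE /= addr0 f0 add0r.
  have xq : `|f x - Phi *m x| <= C * `|x| ^+ 2 by near: x.
  rewrite (le_trans xq)// expr2 mulrA; apply: ler_wpM2r => //.
  apply: (@le_trans _ _ (C * (eps / (C + 1)))); first by apply: ler_wpM2l.
  rewrite mulrCA -[leRHS]mulr1 ler_pM2l// ler_pdivrMr ?mul1r ?lerDl//.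
  by rewrite ltr_wpDl.
have dE := diff_unique (@mulmx_continuous _ _ _ Phi) approx.
have df : differentiable f 0.
  apply/diff_locallyP; rewrite dE; split => //; exact: mulmx_continuous.
split => //; apply/matrixP => i j.
have : diff_mx f 0 *m delta_mx j 0 = Phi *m (delta_mx j 0 : 'cV[R]_n).
  by rewrite -diff_mxE dE.
by rewrite -!colE => /matrixP/(_ i 0); rewrite !mxE.
Unshelve. all: by end_near. Qed.

Lemma flow_diff_at_equilibrium (R : realType) (n : nat) (A : 'M[R]_n)
    (g : 'cV[R]_n -> 'cV[R]_n)
    (hg : g =O_ (nbhs (0 : 'cV[R]_n)) (fun x => `|x| ^+ 2 : R^o))
    (E : 'M[R[i]]_n) (lam : 'I_n -> R[i]) (T t : R) (F : R -> 'cV[R]_n -> 'cV[R]_n) :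
  E \in unitmx -> cplx A *m E = E *m diag_mx (\row_k lam k) ->
  flow_upto (fun x => A *m x + g x) T F -> 0 <= t <= T ->
  [/\ F t 0 = 0, differentiable (F t) 0 &
      cplx (diff_mx (F t) 0) *m E = E *m diag_mx (\row_k cexp (t%:C%C * lam k))].
Proof.
move=> Eu AE flow tT.
have [Phi [PhiE [C [delta [C0 d0 est]]]]] := flow_linearization hg Eu AE tT.
suff quad : \forall x \near (0 : 'cV[R]_n), `|F t x - Phi *m x| <= C * `|x| ^+ 2.
  by have [F0 dF ->] := diff_of_quadratic_error C0 quad.
apply/nbhs_ballP; exists delta => // x; rewrite -ball_normE/= sub0r normrN => xd.
have [F0 [a [b [a0 Tb sol]]]] := flow x.
by have := est a b (F ^~ x) a0 Tb sol; rewrite F0; apply.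
Qed.

Lemma cdiffZ (R : realType) (n : nat) (mu : 'cV[R]_n -> R) (x : 'cV[R]_n)
    (z : R[i]) (w : 'cV[R[i]]_n) : cdiff mu x (z *: w) = z * cdiff mu x w.
Proof.
case: z => a b; rewrite /cdiff.
have -> : re_mx (Complex a b *: w) = a *: re_mx w - b *: im_mx w.
  by apply/matrixP => i j; rewrite !mxE; case: (w i j).
have -> : im_mx (Complex a b *: w) = a *: im_mx w + b *: re_mx w.
  by apply/matrixP => i j; rewrite !mxE; case: (w i j).
by rewrite linearB linearD !linearZ; apply/eqP; rewrite eq_complex /= scalerN !eqxx.
Qed.

(** The derivative of S along a curve of M through 0 is computed twice, by the
    local extension h and, one coordinate at a time, by the chain rule for mu
    composed with the time-j tau map of the ambient space. *)
Lemma delay_map_diff (R : realType) (n p : nat) (mu : 'cV[R]_n -> R) (tau : R)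
    (F : R -> 'cV[R]_n -> 'cV[R]_n) (M : set 'cV[R]_n) (h : 'cV[R]_n -> 'cV[R]_p)
    (U : set 'cV[R]_n) (v : 'cV[R]_n) (j : 'I_p) :
  differentiable (mu : 'cV[R]_n -> R^o) 0 ->
  F (j%:R * tau) 0 = 0 -> differentiable (F (j%:R * tau)) 0 ->
  C1_extends M (delay_map p F mu tau) U h -> U 0 -> tangent M 0 v ->
  (diff_mx h 0 *m v) j 0 =
    'd (mu : 'cV[R]_n -> R^o) 0 (diff_mx (F (j%:R * tau)) 0 *m v).
Proof.
move=> dmu F0 dF ext U0 [gam cg]; have [g0 gM dg] := cg.
have := is_derive_coord j 0 (curve_diff ext U0 cg).
have d1 := is_derive_comp_mx g0 dF dg.
have d2 : is_derive (0 : R) (1 : R) ((mu : 'cV[R]_n -> R^o) \o (F (j%:R * tau) \o gam))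
    ('d (mu : 'cV[R]_n -> R^o) 0 (diff_mx (F (j%:R * tau)) 0 *m v)).
  have e : (F (j%:R * tau) \o gam) 0 = 0 by rewrite /= g0.
  by have := @is_derive_comp1 _ _ _ (mu : 'cV[R]_n -> R^o) _ _ _ _ d1; rewrite e; apply.
have -> : (fun s : R => (delay_map p F mu tau \o gam) s j 0) =
    ((mu : 'cV[R]_n -> R^o) \o (F (j%:R * tau) \o gam)).
  by apply/funext => s; rewrite /= mxE.
by move=> [_ <-]; case: d2.
Qed.

(** * The reduced vector field *)

Lemma quadratic_littleo (R : realType) (n m : nat) (g : 'cV[R]_n -> 'cV[R]_m) (eps : R) :
  g =O_ (nbhs (0 : 'cV[R]_n)) (fun x => `|x| ^+ 2 : R^o) -> 0 < eps ->
  \forall x \near (0 : 'cV[R]_n), `|g x| <= eps * `|x|.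
Proof.
move=> /eqO_exP[k k0 gk] e0.
have small : \forall x \near (0 : 'cV[R]_n), `|x| <= eps / k.
  apply/nbhs_ballP; exists (eps / k) => [|x]; rewrite /= ?divr_gt0//.
  by rewrite -ball_normE/= sub0r normrN => /ltW.
near=> x; have xsmall : `|x| <= eps / k by near: x.
have gx : `|g x| <= k * `| (`|x| ^+ 2 : R^o) | by near: x.
rewrite (le_trans gx)// ger0_norm ?exprn_ge0// expr2 mulrA.
by apply: ler_wpM2r => //; rewrite mulrC -ler_pdivlMr.
Unshelve. all: by end_near. Qed.

Lemma is_derive_translate (R : realType) (V : normedModType R) (y : R -> V) (t : R) v :
  is_derive (0 : R) (1 : R) (fun s => y (s + t)) v <-> is_derive t (1 : R) y v.
Proof.
have e : (fun h : R => h^-1 *: (y (h *: (1 : R) + 0 + t) - y (0 + t))) =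
    (fun h : R => h^-1 *: (y (h *: (1 : R) + t) - y t)).
  by apply/funext => h; rewrite addr0 add0r.
by split => -[d <-]; apply: DeriveDef; move: d; rewrite /derivable /derive/= e.
Qed.

Lemma solution_curve (R : realType) (n : nat) (f : 'cV[R]_n -> 'cV[R]_n)
    (M : set 'cV[R]_n) (a b t : R) (x : R -> 'cV[R]_n) :
  solution_on f a b x -> (forall s, a < s < b -> M (x s)) -> a < t < b ->
  curve_in M (x t) (f (x t)) (fun s => x (s + t)).
Proof.
move=> sol xM /andP[at_ tb]; split; first by rewrite add0r.
  have e0 : 0 < Num.min (t - a) (b - t) by rewrite lt_min !subr_gt0 at_.
  apply/nbhs_ballP; exists (Num.min (t - a) (b - t)) => // s.
  rewrite /ball/= sub0r normrN lt_min !ltr_norml => /andP[/andP[s1 _] /andP[_ s2]].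
  by apply: xM; rewrite -ltrBlDr; apply/andP; split; lra.
by apply/is_derive_translate; apply: sol; rewrite at_.
Qed.

(** The solution through x stays in M and has velocity f x there. *)
Lemma field_tangent (R : realType) (n : nat) (f : 'cV[R]_n -> 'cV[R]_n)
    (M : set 'cV[R]_n) (T : R) (F : R -> 'cV[R]_n -> 'cV[R]_n) (x : 'cV[R]_n) :
  0 <= T -> flow_upto f T F -> flow_invariant f M -> M x -> tangent M x (f x).
Proof.
move=> T0 flow inv Mx; have [F0 [a [b [a0 Tb sol]]]] := flow x.
have ab : a < 0 < b by rewrite a0 (le_lt_trans T0).
exists (fun s => F (s + 0) x); rewrite -{1 2}F0.
by apply: (solution_curve sol) => //; apply: (inv _ _ _ ab sol); rewrite F0.
Qed.

(** With H = Dh(0) and f x = A x + g x, the difference is the sum of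
    (Dh(x) - H) f(x), H g(x), (H A - L H) x and - L (h x - h 0 - H x). The first
    is small by continuity of Dh, the second and the last by order of vanishing,
    and the third because H A - L H kills the tangent space at 0. *)
Lemma reduced_field_estimate (R : realType) (n p d : nat) (A : 'M[R]_n)
    (g : 'cV[R]_n -> 'cV[R]_n) (M : set 'cV[R]_n)
    (S h : 'cV[R]_n -> 'cV[R]_p) (U : set 'cV[R]_n) (L : 'M[R]_p) (eps : R) :
  g =O_ (nbhs (0 : 'cV[R]_n)) (fun x => `|x| ^+ 2 : R^o) ->
  submanifold d M -> M 0 -> C1_extends M S U h -> U 0 ->
  (forall x, M x -> tangent M x (A *m x + g x)) ->
  (forall v, tangent M 0 v -> (diff_mx h 0 *m A - L *m diff_mx h 0) *m v = 0) ->
  0 < eps ->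
  \forall x \near (0 : 'cV[R]_n), M x ->
    `|mdiff M S x (A *m x + g x) - L *m (S x - S 0)| <= eps * `|x|.
Proof.
move=> hg sM M0 ext U0 ftan inter e0; have [oU CkU hS] := ext.
pose H := diff_mx h 0.
have [kA kA0 Alip] := mulmx_lipschitz A.
have [kH kH0 Hlip] := mulmx_lipschitz H.
have [kL kL0 Llip] := mulmx_lipschitz L.
pose D := kA + 1 + kH + 1 + kL.
have D0 : 0 < D by rewrite !addr_gt0.
pose c := Num.min 1 (eps / D).
have c0 : 0 < c by rewrite lt_min ltr01 divr_gt0.
have c1 : c <= 1 by rewrite ge_min lexx.
have cD : c * D <= eps by rewrite -ler_pdivlMr// ge_min lexx orbT.
have near1 := C1_diff_continuous oU U0 CkU c0.
have near2 := quadratic_littleo hg c0.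
have near3 := tangent_approx sM M0 inter c0.
have near4 : \forall x \near (0 : 'cV[R]_n),
    `|h x - h 0 - H *m (x - 0)| <= c * `|x - 0|.
  by apply: filterS (diff_estimate (CkU.1 0 U0) c0) => x; rewrite diff_mxE.
have nU : \forall x \near (0 : 'cV[R]_n), U x by exact: open_nbhs_nbhs.
near=> x => Mx.
have Ux : U x by near: x.
have P1 (v : 'cV[R]_n) : `|diff_mx h x *m v - H *m v| <= c * `|v|.
  by move: v; near: x.
have P2 : `|g x| <= c * `|x| by near: x.
have P3 : `|(H *m A - L *m H) *m (x - 0)| <= c * `|x - 0|.
  by move: Mx; near: x.
have P4 : `|h x - h 0 - H *m (x - 0)| <= c * `|x - 0| by near: x.
rewrite subr0 in P3 P4.
rewrite (mdiff_eq ext Ux (ftan x Mx)) -(hS x Mx Ux) -(hS 0 M0 U0).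
have -> : diff_mx h x *m (A *m x + g x) - L *m (h x - h 0) =
    (diff_mx h x *m (A *m x + g x) - H *m (A *m x + g x)) + H *m g x
    + (H *m A - L *m H) *m x - L *m (h x - h 0 - H *m x).
  rewrite (mulmxBr L _ (H *m x)) mulmxBl (mulmxDr H) !mulmxA.
  move: (diff_mx h x *m _) (L *m (h x - h 0)) (H *m A *m x) (H *m g x) (L *m H *m x).
  by move=> v1 v2 v3 v4 v5; apply/matrixP => i j; rewrite !mxE; ring.
have x0 : 0 <= `|x| by [].
have Q1 : `|diff_mx h x *m (A *m x + g x) - H *m (A *m x + g x)| <= c * ((kA + 1) * `|x|).
  apply: le_trans (P1 _) _; rewrite ler_pM2l// (le_trans (ler_normD _ _))//.
  rewrite mulrDl mul1r lerD// (le_trans P2)//.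
  by rewrite -[leRHS]mul1r; apply: ler_wpM2r.
have Q2 : `|H *m g x| <= kH * (c * `|x|) by rewrite (le_trans (Hlip _))// ler_pM2l.
have Q4 : `|L *m (h x - h 0 - H *m x)| <= kL * (c * `|x|).
  by rewrite (le_trans (Llip _))// ler_pM2l.
apply: (@le_trans _ _ (c * ((kA + 1) * `|x|) + kH * (c * `|x|) + c * `|x|
  + kL * (c * `|x|))).
  apply: le_trans (ler_normB _ _) _; apply: lerD => //.
  apply: le_trans (ler_normD _ _) _; apply: lerD => //.
  by apply: le_trans (ler_normD _ _) _; apply: lerD.
rewrite (_ : _ + _ = c * D * `|x|); last by rewrite /D; ring.
exact: ler_wpM2r.
Unshelve. all: by end_near. Qed.

(** Small-o estimates on M pull back to N because psi is Lipschitz at y0. *)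
Lemma transport_littleo (R : realType) (n p : nat) (N : set 'cV[R]_p)
    (psi k : 'cV[R]_p -> 'cV[R]_n) (U : set 'cV[R]_p) (y0 : 'cV[R]_p)
    (P : 'cV[R]_p -> R) (M : set 'cV[R]_n) (Q : 'cV[R]_n -> R) :
  C1_extends N psi U k -> U y0 -> N y0 ->
  (forall y, N y -> M (psi y)) -> (forall y, N y -> P y = Q (psi y)) ->
  (forall eps, 0 < eps ->
    \forall x \near psi y0, M x -> Q x <= eps * `|x - psi y0|) ->
  forall eps, 0 < eps ->
    \forall y \near within N (nbhs y0), P y <= eps * `|y - y0|.
Proof.
move=> [oU [dk _] kpsi] Uy0 Ny0 psiM PQ est eps e0.
have [c c0 klip] := diff_lipschitz_at (dk y0 Uy0).
have near1 := est _ (divr_gt0 e0 c0).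
have kcont : {for y0, continuous k} by exact: differentiable_continuous (dk y0 Uy0).
have near2 : \forall y \near y0, M (k y) -> Q (k y) <= eps / c * `|k y - psi y0|.
  have near1' : nbhs (k y0) [set x | M x -> Q x <= eps / c * `|x - psi y0|].
    by rewrite kpsi.
  exact: (kcont _ near1').
have nU : \forall y \near y0, U y by exact: open_nbhs_nbhs.
rewrite near_withinE; near=> y => Ny.
have Uy : U y by near: y.
have kyE : k y = psi y by rewrite kpsi.
have h1 : `|k y - k y0| <= c * `|y - y0| by near: y.
have h2 : M (k y) -> Q (k y) <= eps / c * `|k y - psi y0| by near: y.
rewrite PQ// -kyE (le_trans (h2 _))//; first by rewrite kyE; exact: psiM.
rewrite mulrAC -mulrA ler_pM2l// ler_pdivrMr// mulrC.
by move: h1; rewrite (kpsi y0).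
Unshelve. all: by end_near. Qed.

(** * Modes of the delay map and the reduced linearization *)

Lemma cplxM (R : realType) (m n q : nat) (B : 'M[R]_(m, n)) (C : 'M[R]_(n, q)) :
  cplx (B *m C) = cplx B *m cplx C.
Proof. exact: map_mxM. Qed.

Lemma cplxB (R : realType) (m n : nat) (B C : 'M[R]_(m, n)) :
  cplx (B - C) = cplx B - cplx C.
Proof. exact: map_mxB. Qed.

Lemma re_cplxM (R : realType) (m n q : nat) (B : 'M[R]_(m, n)) (w : 'M[R[i]]_(n, q)) :
  re_mx (cplx B *m w) = B *m re_mx w.
Proof. by rewrite re_mxM re_cplx im_cplx mul0mx subr0. Qed.

Lemma im_cplxM (R : realType) (m n q : nat) (B : 'M[R]_(m, n)) (w : 'M[R[i]]_(n, q)) :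
  im_mx (cplx B *m w) = B *m im_mx w.
Proof. by rewrite im_mxM re_cplx im_cplx mul0mx addr0. Qed.

Lemma ctangent_cplx (R : realType) (n : nat) (M : set 'cV[R]_n) x v :
  M x -> tangent M x v -> ctangent M x (cplx v).
Proof.
by move=> Mx tv; split; rewrite ?re_cplx ?im_cplx//; exact: tangent0.
Qed.

Lemma ctangent_conj (R : realType) (n : nat) (M : set 'cV[R]_n) x w :
  ctangent M x w -> ctangent M x (conj_mx w).
Proof.
by move=> [tr ti]; split; rewrite ?re_conj_mx ?im_conj_mx//; exact: tangentN.
Qed.

Lemma mul_colE (C : pzRingType) (m n d : nat) (B : 'M[C]_(m, n)) (e : 'I_d -> 'cV[C]_n) :
  B *m (\matrix_(i, k) e k i 0) = \matrix_(i, k) (B *m e k) i 0.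
Proof.
by apply/matrixP => i k; rewrite !mxE; apply: eq_bigr => j _; rewrite mxE.
Qed.

(** The linearized flow multiplies e_k by exp(j tau lambda_k) and the
    complex-linear extension of Dmu(0) takes this factor out, so that modes turn
    into columns of the Vandermonde matrix. *)
Lemma delay_map_modes (R : realType) (n p : nat) (A : 'M[R]_n)
    (g : 'cV[R]_n -> 'cV[R]_n) (lam : 'I_n -> R[i]) (e : 'I_n -> 'cV[R[i]]_n)
    (mu : 'cV[R]_n -> R) (tau : R) (F : R -> 'cV[R]_n -> 'cV[R]_n)
    (M : set 'cV[R]_n) (h : 'cV[R]_n -> 'cV[R]_p) (U : set 'cV[R]_n) (k : 'I_n) :
  g =O_ (nbhs (0 : 'cV[R]_n)) (fun x => `|x| ^+ 2 : R^o) ->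
  (forall k, cplx A *m e k = lam k *: e k) ->
  \matrix_(i, k) e k i 0 \in unitmx ->
  differentiable (mu : 'cV[R]_n -> R^o) 0 -> 0 < tau ->
  flow_upto (fun x => A *m x + g x) (p.-1%:R * tau) F ->
  C1_extends M (delay_map p F mu tau) U h -> U 0 -> ctangent M 0 (e k) ->
  cplx (diff_mx h 0) *m e k =
    cdiff mu 0 (e k) *: \col_j cexp (j%:R * lam k * tau%:C%C).
Proof.
move=> hg heig Eu dmu tau0 hF ext U0 [tre tim].
set E := \matrix_(i, k) e k i 0 in Eu.
have AE : cplx A *m E = E *m diag_mx (\row_k lam k).
  rewrite mul_colE mul_mx_diag; apply/matrixP => i j; rewrite [LHS]mxE heig !mxE.
  by rewrite mulrC.
apply/matrixP => j z; rewrite {z}ord1 [RHS]mxE [(\col_ _ _) j 0]mxE.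
have jT : 0 <= j%:R * tau <= p.-1%:R * tau.
  rewrite mulr_ge0 ?(ltW tau0)//= ler_pM2r// ler_nat.
  by rewrite -ltnS prednK ?ltn_ord// (leq_ltn_trans _ (ltn_ord j)).
have [F0 dF PhiE] := flow_diff_at_equilibrium hg Eu AE hF jT.
have Phie : cplx (diff_mx (F (j%:R * tau)) 0) *m e k =
    cexp ((j%:R * tau)%:C%C * lam k) *: e k.
  apply/matrixP => i z; rewrite {z}ord1.
  have /matrixP/(_ i k) := PhiE.
  by rewrite mul_colE mul_mx_diag [LHS]mxE => ->; rewrite !mxE mulrC.
have re_im (w : 'cV[R[i]]_p) : w j 0 = Complex (re_mx w j 0) (im_mx w j 0).
  by rewrite !mxE; case: (w j 0).
rewrite re_im re_cplxM im_cplxM.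
rewrite (delay_map_diff dmu F0 dF ext U0 tre) (delay_map_diff dmu F0 dF ext U0 tim).
rewrite -re_cplxM -im_cplxM -[LHS]/(cdiff mu 0 _) Phie cdiffZ mulrC.
congr (_ * cexp _); rewrite rmorphM/= rmorph_nat; ring.
Qed.

Theorem theorem2 (R : realType) (n d p : nat) (hdn : (d <= n)%N)
  (l : smoothness)
  (A : 'M[R]_n) (g : 'cV[R]_n -> 'cV[R]_n)
  (hclass : of_class l (fun x => A *m x + g x))
  (hg : g =O_ (nbhs (0 : 'cV[R]_n)) (fun x => `|x| ^+ 2 : R^o))
  (lam : 'I_n -> R[i]) (e : 'I_n -> 'cV[R[i]]_n)
  (heig : forall k, cplx A *m e k = lam k *: e k)
  (hdiag : \matrix_(i, k) e k i 0 \in unitmx)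
  (mu : 'cV[R]_n -> R)
  (hmu : forall x, differentiable (mu : 'cV[R]_n -> R^o) x)
  (tau : R) (htau : 0 < tau)
  (F : R -> 'cV[R]_n -> 'cV[R]_n)
  (hF : flow_upto (fun x => A *m x + g x) (p.-1%:R * tau) F)
  (M : set 'cV[R]_n)
  (hM : submanifold d M) (hM0 : M 0)
  (hMinv : flow_invariant (fun x => A *m x + g x) M)
  (hMtan : ctangent M 0 =
     [set w | exists c : 'I_d -> R[i],
                w = \sum_(k < d) c k *: e (widen_ord hdn k)])
  (Psiinv : 'cV[R]_p -> 'cV[R]_n)
  (hemb : C1_embedding M (delay_map p F mu tau) Psiinv)
  (hgen : forall k : 'I_d, cdiff mu 0 (e (widen_ord hdn k)) != 0)
  (hdist : injective (fun k : 'I_d => lam (widen_ord hdn k))) :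
  let S : 'cV[R]_n -> 'cV[R]_p := delay_map p F mu tau in
  let Mt := S @` M in
  let y0 := S 0 in
  let ft := delay_field (fun x => A *m x + g x) M S Psiinv in
  let V : 'M[R[i]]_(p, d) :=
    delay_vandermonde p (fun k => lam (widen_ord hdn k)) tau in
  let Lam : 'M[R[i]]_d := diag_mx (\row_k lam (widen_ord hdn k)) in
  ((exists L : 'M[R]_p, linearization Mt ft y0 L) /\
   (forall L : 'M[R]_p, linearization Mt ft y0 L ->
      forall k : 'I_d,
        tangent_eigenvector Mt y0 L (lam (widen_ord hdn k)) (col k V))) /\
  (exists r : 'cV[R]_p -> 'cV[R]_p,
     r =o_ (within Mt (nbhs y0)) (fun y => y - y0) /\
     forall (a b : R) (x : R -> 'cV[R]_n),
       solution_on (fun x => A *m x + g x) a b x ->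
       (forall t : R, a < t < b -> M (x t)) ->
       forall t : R, a < t < b ->
         derivable (S \o x) t (1 : R) /\
         cplx ('D_1 (S \o x) t) =
           V *m Lam *m mppinv V *m cplx (S (x t) - y0) + cplx (r (S (x t)))).
Proof.
move=> S Mt y0 ft V Lam.
pose ed k := e (widen_ord hdn k); pose lamd k := lam (widen_ord hdn k).
pose Ed : 'M[R[i]]_(n, d) := \matrix_(i, k) ed k i 0.
have T0 : 0 <= p.-1%:R * tau by rewrite mulr_ge0// (ltW htau).
have Mty0 : Mt y0 by exists 0.
have [hS hPsi PsiS] := hemb.
have [U [h [oU U0 Ckh hSE]]] := hS 0 hM0.
have [U' [ka [oU' U'y0 Ckk kPsi]]] := hPsi y0 Mty0.
have extS : C1_extends M S U h by [].
have extPsi : C1_extends Mt Psiinv U' ka by [].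
have Psiy0 : Psiinv y0 = 0 by exact: PsiS.
pose H := diff_mx h 0; pose K := diff_mx ka y0.
have ftan x : M x -> tangent M x (A *m x + g x) := field_tangent T0 hF hMinv.
have ted k : ctangent M 0 (ed k).
  rewrite hMtan; exists (fun i => (i == k)%:R).
  rewrite (bigD1 k)//= eqxx scale1r big1 ?addr0// => i /negPf ->.
  by rewrite scale0r.
have spanE w : ctangent M 0 w <-> exists c : 'cV_d, w = Ed *m c.
  have span c : \sum_(k < d) c k *: ed k = Ed *m \col_k c k.
    apply/matrixP => i j; rewrite ord1 summxE !mxE; apply: eq_bigr => k _.
    by rewrite !mxE mulrC.
  rewrite hMtan; split => [[c ->]|[c ->]].
    by exists (\col_k c k); rewrite -span.
  exists (fun k => c k 0); rewrite span; congr (_ *m _).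
  by apply/matrixP => i j; rewrite ord1 mxE.
(* Chain rule for the composition of S with its inverse: DS(0) is injective on
   the tangent space. *)
have KH v : tangent M 0 v -> K *m (H *m v) = v.
  move=> [gam cg]; have cS := curve_image extS U0 cg.
  have d1 := curve_diff extPsi U'y0 cS.
  have [g0 gM dg] := cg.
  have : is_derive (0 : R) (1 : R) (Psiinv \o (S \o gam)) v.
    apply: near_eq_is_derive dg.
    by apply: filterS gM => t Mt'; rewrite /= PsiS.
  by move=> [_ Dv]; case: d1 => _ DKH; exact: etrans (esym DKH) Dv.
have PsiM y : Mt y -> M (Psiinv y) by move=> [x Mx <-]; rewrite PsiS.
have SPsi y : Mt y -> S (Psiinv y) = y by move=> [x Mx <-]; rewrite PsiS.
have tMt u : tangent Mt y0 u -> tangent M 0 (K *m u) /\ H *m (K *m u) = u.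
  move=> [eta ce]; have [e0 eM de] := ce.
  have cP : curve_in M 0 (K *m u) (Psiinv \o eta).
    have [p0 pM dp] := curve_image extPsi U'y0 ce; split => //.
      by rewrite p0 Psiy0.
    by apply: filterS eM => t; exact: PsiM.
  split; first by eexists; exact: cP.
  have [_ DHK] := curve_diff extS U0 cP.
  have : is_derive (0 : R) (1 : R) (S \o (Psiinv \o eta)) u.
    apply: near_eq_is_derive de.
    by apply: filterS eM => t Mt'; rewrite /= SPsi.
  by move=> [_ Du]; exact: etrans (esym DHK) Du.
pose c := \row_k cdiff mu 0 (ed k).
have HE : cplx H *m Ed = V *m diag_mx c.
  rewrite mul_colE mul_mx_diag; apply/matrixP => j k; rewrite [LHS]mxE.
  rewrite (delay_map_modes hg heig hdiag (hmu 0) htau hF extS U0 (ted k)).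
  by rewrite !mxE mulrC.
have c0 k : c 0 k != 0 by rewrite mxE; exact: hgen.
have KHE : cplx K *m (cplx H *m Ed) = Ed.
  rewrite mulmxA -cplxM mul_colE; apply/matrixP => i k; rewrite [LHS]mxE [RHS]mxE.
  have [tre tim] := ted k.
  suff -> : cplx (K *m H) *m ed k = ed k by [].
  by apply: complex_mx_eq; rewrite ?re_cplxM ?im_cplxM -mulmxA KH.
have AE : cplx A *m Ed = Ed *m diag_mx (\row_k lamd k).
  rewrite mul_colE mul_mx_diag; apply/matrixP => i k; rewrite [LHS]mxE heig !mxE.
  by rewrite mulrC.
(* Reversing a curve negates its velocity, so the complexified tangent space is
   stable under conjugation. *)
have [P EP] : exists P, conj_mx Ed = Ed *m P.
  have hP k : exists a : 'cV_d, conj_mx (ed k) = Ed *m a.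
    by apply/spanE/ctangent_conj.
  exists (\matrix_(i, k) (sval (cid (hP k))) i 0).
  rewrite mul_colE; apply/matrixP => i k; rewrite [RHS]mxE -(svalP (cid (hP k))).
  by rewrite !mxE.
(* The first d rows of the inverse of the full eigenvector matrix. *)
have [Li LE] : exists Li : 'M[R[i]]_(d, n), Li *m Ed = 1%:M.
  exists (\matrix_(k, i) invmx (\matrix_(i, k) e k i 0) (widen_ord hdn k) i).
  apply/matrixP => k k'.
  have /matrixP/(_ (widen_ord hdn k) (widen_ord hdn k')) := mulVmx hdiag.
  rewrite [LHS]mxE [RHS]mxE => inv; rewrite [LHS]mxE [RHS]mxE.
  rewrite -[k == k']/(widen_ord hdn k == widen_ord hdn k') -inv.
  by apply: eq_bigr => i _; congr (_ * _); rewrite !mxE.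
pose B := V *m Lam *m mppinv V; pose L0 := re_mx B.
(* Li K V diag(c) = Li K H Ed = 1, so diag(c) Li K is a left inverse of V. *)
have VV : mppinv V *m V = 1%:M.
  apply: (mppinv_left_inverse (X := diag_mx c *m (Li *m cplx K))).
  rewrite -mulmxA; apply: mulmx1C.
  by rewrite -!mulmxA -HE KHE.
have L0B : cplx L0 = B.
  by apply: cplx_re_mx; exact: (reduced_matrix_real HE c0 AE EP VV).
have inter v : tangent M 0 v -> (H *m A - L0 *m H) *m v = 0.
  move=> /(ctangent_cplx hM0)/spanE[a va].
  have N0 : cplx (H *m A - L0 *m H) *m Ed = 0.
    rewrite cplxB !cplxM mulmxBl -!mulmxA L0B.
    by rewrite (reduced_matrix_intertwines HE AE VV) subrr.
  rewrite -[LHS]re_cplx cplxM va mulmxA N0 mul0mx.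
  by apply/matrixP => i j; rewrite !mxE.
have est eps : 0 < eps ->
    \forall y \near within Mt (nbhs y0), `|ft y - L0 *m (y - y0)| <= eps * `|y - y0|.
  pose Q x := `|mdiff M S x (A *m x + g x) - L0 *m (S x - S 0)|.
  apply: (transport_littleo (Q := Q) extPsi U'y0 Mty0 PsiM).
    by move=> y Mty; rewrite /Q /ft /delay_field SPsi.
  move=> e' e'0; rewrite Psiy0.
  have := reduced_field_estimate hg hM hM0 extS U0 ftan inter e'0.
  by apply: filterS => x; rewrite subr0.
have fty0 : ft y0 = 0.
  have := nbhs_singleton (est 1 ltr01).
  by move=> /(_ Mty0); rewrite !subrr mulmx0 subr0 normr0 mulr0 normr_le0 => /eqP.
have rlo : (fun y => ft y - L0 *m (y - y0)) =o_ (within Mt (nbhs y0)) (fun y => y - y0).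
  by apply/eqoP => eps e0; exact: est.
have linL0 : linearization Mt ft y0 L0.
  split => // u /tMt[tv Hu].
  have tAv : tangent M 0 (A *m (K *m u)).
    rewrite -[A *m _]re_cplx.
    suff [] : ctangent M 0 (cplx (A *m (K *m u))) by [].
    have /spanE[a va] := ctangent_cplx hM0 tv.
    apply/spanE; exists (diag_mx (\row_k lamd k) *m a).
    by rewrite cplxM va !mulmxA AE.
  have -> : L0 *m u = H *m (A *m (K *m u)).
    move: (inter _ tv); rewrite mulmxBl -!mulmxA Hu => /eqP.
    by rewrite subr_eq0 => /eqP.
  exact: (tangent_image extS U0 tAv).
split; [split; first by exists L0|].
  move=> L [_ _ Lo] k.
  have LL0 u : tangent Mt y0 u -> L *m u = L0 *m u.
    move=> tu; apply/eqP; rewrite -subr_eq0 -mulmxBl; apply/eqP.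
    apply: (tangent_kernel _ tu) => eps e0.
    have e2 : 0 < eps / 2 by rewrite divr_gt0.
    have /eqoP/(_ _ e2) h1 := Lo; have h2 := est _ e2.
    apply: filterS (filterI h1 h2) => y [h1y h2y].
    have -> : (L - L0) *m (y - y0) =
        (ft y - L0 *m (y - y0)) - (ft y - L *m (y - y0)).
      by rewrite mulmxBl opprB [RHS]addrC addrA subrK.
    rewrite (le_trans (ler_normB _ _))// [X in X * _]splitr mulrDl.
    by apply: lerD; [exact: h2y | exact: h1y].
  (* Genericity makes the k-th column the image of a tangent vector. *)
  have VE : col k V = cplx H *m ((c 0 k)^-1 *: ed k).
    rewrite -scalemxAr (delay_map_modes hg heig hdiag (hmu 0) htau hF extS U0 (ted k)).
    have ck : cdiff mu 0 (ed k) != 0 by exact: hgen.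
    rewrite scalerA mxE mulVf// scale1r.
    by apply/matrixP => i j; rewrite !mxE.
  have [tr ti] : ctangent M 0 ((c 0 k)^-1 *: ed k).
    apply/spanE; exists ((c 0 k)^-1 *: delta_mx k 0).
    rewrite -scalemxAr -colE; congr (_ *: _).
    by apply/matrixP => i j; rewrite ord1 !mxE.
  have tV : tangent Mt y0 (re_mx (col k V)) /\ tangent Mt y0 (im_mx (col k V)).
    by rewrite VE re_cplxM im_cplxM; split; exact: (tangent_image extS U0).
  split => //.
    apply/eqP => Vk0; have := congr1 (fun X => X *m (delta_mx k 0 : 'cV_d)) VV.
    rewrite -mulmxA -colE Vk0 mulmx0 mul1mx => /matrixP/(_ k 0).
    by rewrite !mxE !eqxx/= => /esym/eqP; rewrite oner_eq0.
  have [tVr tVi] := tV.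
  have -> : cplx L *m col k V = cplx L0 *m col k V.
    by apply: complex_mx_eq; rewrite ?re_cplxM ?im_cplxM LL0.
  rewrite L0B colE /B -!mulmxA (mulmxA (mppinv V)) VV mul1mx.
  suff -> : Lam *m delta_mx k 0 = lamd k *: (delta_mx k 0 : 'cV_d) by rewrite -scalemxAr.
  apply/matrixP => i j; rewrite mul_diag_mx ord1 !mxE.
  by have [->//|] := eqVneq i k; rewrite !mulr0.
exists (fun y => ft y - L0 *m (y - y0)); split => // a b x sol xM t tab.
have cx := solution_curve sol xM tab.
have [W [hx [oW Wx CkW hxE]]] := hS (x t) (xM t tab).
have extx : C1_extends M S W hx by [].
have dSx : is_derive t (1 : R) (S \o x) (ft (S (x t))).
  rewrite /ft /delay_field PsiS; last exact: xM.
  rewrite (mdiff_eq extx Wx); last by eexists; exact: cx.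
  by apply/is_derive_translate; exact: (curve_diff extx Wx cx).
have [dSx1 dSx2] := dSx; split => //; rewrite dSx2 -/B -L0B -cplxM.
by rewrite cplxB addrC subrK.
Qed.
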